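(* Let $R$ be an integral domain. For an $R$-module $M$, let $T(M)$ denote its torsion submodule. Then the following statements are equivalent: (1) $R$ is a P$v$MD. (2) For every $R$-module $M$, $T(M)$ is a $w$-pure submodule of $M$. (2') For every finitely generated $R$-module $M$, $T(M)$ is a $w$-pure submodule of $M$. (3) For every finitely generated $R$-module $M$, the module $M/T(M)$ is $w$-projective. (4) For every $w$-finitely generated $R$-module $M$, the module $M/T(M)$ is $w$-projective. (5) For every finitely generated $R$-module $M$, $M/T(M)$ is a $w$-split module. (6) For every $w$-finitely generated $R$-module $M$, $M/T(M)$ is a $w$-split module. (7) For every finitely generated $R$-module $M$, the canonical exact sequence $0\to T(M)\to M\to M/T(M)\to 0$ is $w$-split. (8) For every $w$-finitely generated $R$-module $M$, the canonical exact sequence $0\to T(M)\to M\to M/T(M)\to 0$ is $w$-split.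
   Context: $R$ is an integral domain with $1\ne 0$ and quotient field $K$; modules are unitary. The torsion submodule is $T(M)=\{x\in M: rx=0 \text{ for some } 0\neq r\in R\}$. A finitely generated ideal $J$ of $R$ is a GV-ideal, $J\in \mathrm{GV}(R)$, if the natural map $R\to\operatorname{Hom}_R(J,R)$, $r\mapsto (x\mapsto rx)$, is an isomorphism. For an $R$-module $M$, $\operatorname{tor}_{\mathrm{GV}}(M)=\{x\in M: Jx=0\text{ for some }J\in \mathrm{GV}(R)\}$; $M$ is GV-torsion if $\operatorname{tor}_{\mathrm{GV}}(M)=M$ and GV-torsion-free if $\operatorname{tor}_{\mathrm{GV}}(M)=0$. For $M$ GV-torsion-free with injective envelope $E(M)$, $M_w=\{x\in E(M): Jx\subseteq M\text{ for some }J\in \mathrm{GV}(R)\}$, and $M$ is a $w$-module if $M_w=M$. A $w$-ideal is an ideal of $R$ that is a $w$-module; $w\text{-}\mathrm{Max}(R)$ is the set of ideals maximal among proper $w$-ideals (these are prime). A sequence (resp. homomorphism) is $w$-exact (resp. a $w$-monomorphism, $w$-epimorphism) if its localization at every $\mathfrak m\in w\text{-}\mathrm{Max}(R)$ is exact (resp. injective, surjective). $R$ is a P$v$MD (Prüfer $v$-multiplication domain) if every nonzero finitely generated ideal $I$ of $R$ is $w$-invertible, i.e. $(II^{-1})_w=R$, where $I^{-1}=\{x\in K: Ix\subseteq R\}$. $M$ is $w$-finitely generated if there is a $w$-epimorphism $F\to M$ with $F$ finitely generated free. $M$ is $w$-projective if $\operatorname{Ext}^1_R(L(M),N)$ is GV-torsion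 for every torsion-free $w$-module $N$, where $L(M)=(M/\operatorname{tor}_{\mathrm{GV}}(M))_w$. A short exact sequence $0\to A\to B\xrightarrow{g} C\to 0$ is $w$-split if there are $J=\langle d_1,\dots,d_n\rangle\in\mathrm{GV}(R)$ and $h_1,\dots,h_n\in\operatorname{Hom}_R(C,B)$ with $d_k\cdot\mathrm{Id}_C=g h_k$ for all $k$. A module $M$ is $w$-split if there is a $w$-split short exact sequence $0\to L\to P\to M\to 0$ with $P$ projective. A short exact sequence $0\to A\to B\to C\to 0$ is $w$-pure if for every $R$-module $N$ the sequence $0\to N\otimes_R A\to N\otimes_R B\to N\otimes_R C\to 0$ is $w$-exact; a submodule $A\subseteq B$ is $w$-pure if $0\to A\to B\to B/A\to 0$ is $w$-pure. *)

(* Defs.v *)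
From HB Require Import structures.
From mathcomp Require Import all_boot all_algebra.
From mathcomp Require Import boolp classical_sets functions.
From mathcomp Require Import freeg ring.

Set Implicit Arguments.
Unset Strict Implicit.
Unset Printing Implicit Defensive.

Import GRing.Theory.
Local Open Scope ring_scope.
Local Open Scope quotient_scope.

Definition surjective (A B : Type) (f : A -> B) := forall y, exists x, f x = y.

Section Submodules.
Variables (R : idomainType) (M : lmodType R).

Definition subMod (S : submodClosed M) := {x : M | x \in S}.
HB.instance Definition _ S := SubChoice.on (subMod S).
HB.instance Definition _ S := [SubChoice_isSubLmodule of subMod S by <:].

Definition incl (S : submodClosed M) : {linear subMod S -> M} := val.

Definition generated (X : set M) : {pred M} :=
  fun x =>
    `[< forall S : submodClosed M, (X `<=` [set` S])%classic -> x \in S >].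

Lemma generated_closed X : submod_closed (generated X).
Proof.
split=> [|a u v /asboolP Xu /asboolP Xv]; apply/asboolP => S sXS.
  exact: rpred0.
by rewrite rpredD ?rpredZ ?Xu ?Xv.
Qed.
HB.instance Definition _ X :=
  GRing.isSubmodClosed.Build R M (generated X) (generated_closed X).

Definition span n (v : 'I_n -> M) : {pred M} :=
  fun x => `[< exists a : 'I_n -> R, x = \sum_i a i *: v i >].

Lemma span_closed n (v : 'I_n -> M) : submod_closed (span v).
Proof.
split=> [|c u w /asboolP[a ->] /asboolP[b ->]]; apply/asboolP.
  by exists (fun=> 0); rewrite big1 // => i _; rewrite scale0r.
exists (fun i => c * a i + b i); rewrite scaler_sumr -big_split /=.
by apply: eq_bigr => i _; rewrite scalerDl scalerA.
Qed.
HB.instance Definition _ n (v : 'I_n -> M) :=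
  GRing.isSubmodClosed.Build R M (span v) (span_closed v).

Definition fg_sub (S : submodClosed M) := exists n (v : 'I_n -> M), S =i span v.

Definition finitely_generated :=
  exists n (v : 'I_n -> M), forall x, x \in span v.

Definition torsion : {pred M} :=
  fun x => `[< exists2 r : R, r != 0 & r *: x = 0 >].

Lemma torsion_closed : submod_closed torsion.
Proof.
split=> [|a u v /asboolP[r r0 ru] /asboolP[s s0 sv]]; apply/asboolP.
  by exists 1; rewrite ?oner_eq0 ?scaler0.
exists (r * s); first by rewrite mulf_neq0.
rewrite scalerDr -[(r * s) *: v]scalerA sv scaler0 addr0.
by rewrite scalerA mulrC -scalerA [r * s]mulrC -scalerA ru !scaler0.
Qed.
HB.instance Definition _ :=
  GRing.isSubmodClosed.Build R M torsion torsion_closed.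

Definition torsion_free := forall x : M, x \in torsion -> x = 0.

End Submodules.

Arguments torsion {R} M.
Arguments torsion_free {R} M.
Arguments finitely_generated {R} M.

Section Quotients.
Variables (R : idomainType) (M : lmodType R) (S : submodClosed M).

Let zS : {pred M} := fun x => x \in S.
Let zS_closed : zmod_closed zS.
Proof.
split=> [|x y Sx Sy]; first exact: (rpred0 S).
by rewrite -scaleN1r; apply: (@rpredD _ S) => //; apply: (@rpredZ _ _ S).
Qed.
HB.instance Definition _ := GRing.isZmodClosed.Build M zS zS_closed.

Definition quotMod : Type := Quotient.quot zS.
HB.instance Definition _ := GRing.Zmodule.on quotMod.
HB.instance Definition _ := EqQuotient.on quotMod.

Lemma quotModP (x y : M) :
  reflect (\pi_quotMod x = \pi_quotMod y) (x - y \in S).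
Proof.
suff -> : (x - y \in S) = (x == y %[mod quotMod]) by exact: eqP.
by rewrite -Quotient.idealrBE.
Qed.

Let qscale (a : R) (q : quotMod) : quotMod := \pi_quotMod (a *: repr q).

Let pi_scale a x : qscale a (\pi_quotMod x) = \pi_quotMod (a *: x).
Proof.
apply/quotModP; rewrite -scalerBr; apply: rpredZ.
by apply/quotModP; rewrite reprK.
Qed.

Let piB : {morph \pi_quotMod : x y / x + y}.
Proof. exact: (@Quotient.pi_add M zS). Qed.

Let scaleA a b q : qscale a (qscale b q) = qscale (a * b) q.
Proof. by rewrite -[q]reprK (pi_scale b) !pi_scale scalerA. Qed.
Let scale1 : left_id 1 qscale.
Proof. by move=> q; rewrite -[q]reprK pi_scale scale1r. Qed.
Let scaleDr : right_distributive qscale +%R.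
Proof.
by move=> a q r; rewrite -[q]reprK -[r]reprK -piB !pi_scale scalerDr -piB.
Qed.
Let scaleDl q : {morph qscale^~ q : a b / a + b}.
Proof. by move=> a b; rewrite -[q]reprK !pi_scale scalerDl -piB. Qed.

HB.instance Definition _ := GRing.Zmodule_isLmodule.Build R quotMod
  scaleA scale1 scaleDr scaleDl.

Definition qproj (x : M) : quotMod := \pi_quotMod x.

Lemma qproj_linear : linear qproj.
Proof. by move=> a x y; rewrite /qproj piB -pi_scale. Qed.
HB.instance Definition _ :=
  GRing.isLinear.Build R M quotMod _ qproj qproj_linear.

End Quotients.

Section Homs.
Variables (R : idomainType).
Implicit Types U V : lmodType R.

Definition kernel U V (f : {linear U -> V}) : {pred U} := fun x => f x == 0.

Lemma kernel_closed U V (f : {linear U -> V}) : submod_closed (kernel f).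
Proof.
split=> [|a x y /eqP fx /eqP fy]; apply/eqP; first exact: linear0.
by rewrite linearP fx fy scaler0 addr0.
Qed.
HB.instance Definition _ U V (f : {linear U -> V}) :=
  GRing.isSubmodClosed.Build R U (kernel f) (kernel_closed f).

Definition image U V (f : {linear U -> V}) : {pred V} :=
  fun y => `[< exists x, f x = y >].

Lemma image_closed U V (f : {linear U -> V}) : submod_closed (image f).
Proof.
split=> [|a _ _ /asboolP[x <-] /asboolP[y <-]]; apply/asboolP.
  by exists 0; rewrite linear0.
by exists (a *: x + y); rewrite linearP.
Qed.
HB.instance Definition _ U V (f : {linear U -> V}) :=
  GRing.isSubmodClosed.Build R V (image f) (image_closed f).

Definition is_linear U V : {pred U -> V} := fun f => `[< linear f >].

Lemma is_linear_closed U V : submod_closed (@is_linear U V).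
Proof.
split=> [|a f g /asboolP lf /asboolP lg]; apply/asboolP => c x y.
  by rewrite /= scaler0 addr0.
rewrite ![(a *: f + g) _]/(a *: f _ + g _) lf lg !scalerDr !scalerA.
by rewrite [c * a]mulrC addrACA.
Qed.
HB.instance Definition _ U V := GRing.isSubmodClosed.Build R (U -> V)
  (@is_linear U V) (is_linear_closed U V).

Definition Hom U V := subMod (@is_linear U V).
HB.instance Definition _ U V := GRing.SubLmodule.on (Hom U V).

Definition mkHom U V (f : U -> V) (lf : linear f) : Hom U V :=
  exist _ f (asboolT lf).

Lemma val_Hom_linear U V (f : Hom U V) : linear (val f).
Proof. by apply/asboolP; exact: (valP f). Qed.

End Homs.

Section GV.
Variable R : idomainType.

Definition ideal := submodClosed R^o.

Lemma homothety_linear (J : ideal) (r : R) :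
  linear (fun x : subMod J => r * val x : R^o).
Proof. by move=> a x y; rewrite linearP /= mulrDr [r * _]mulrCA. Qed.

Definition homothety (J : ideal) (r : R) : Hom (subMod J) R^o :=
  mkHom (@homothety_linear J r).

Definition GV (J : ideal) := fg_sub J /\ bijective (homothety J).

Lemma homothety_eq (J : ideal) (r : R) (f : Hom (subMod J) R^o) :
  homothety J r = f <-> forall x : subMod J, val f x = r * val x.
Proof.
split=> [<- // | fE]; apply: val_inj; apply/funext => x /=.
by rewrite fE.
Qed.

Lemma GVE (J : ideal) :
  GV J <-> [/\ fg_sub J,
    (forall r : R, (forall x : R, x \in J -> r * x = 0) -> r = 0) &
    (forall f : subMod J -> R^o, linear f ->
       exists r : R, forall x, f x = r * val x)].
Proof.
split=> [[fgJ [g gK Kg]] | [fgJ injJ surJ]].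
  split=> // [r r0 | f lf].
    apply: (can_inj gK); apply/homothety_eq => x /=.
    by rewrite mul0r r0 //; exact: (valP x).
  exists (g (mkHom lf)) => x.
  by rewrite -[f]/(val (mkHom lf)) -{1}[mkHom lf]Kg.
split=> //; have sur (f : Hom (subMod J) R^o) : exists r, homothety J r = f.
  have [r rE] := surJ (val f) (val_Hom_linear f).
  by exists r; apply/homothety_eq.
have [g gE] := choice sur; exists g => // r.
have /homothety_eq rE := gE (homothety J r).
apply/eqP; rewrite -subr_eq0; apply/eqP; apply: injJ => x xJ.
by rewrite mulrBl -(rE (exist _ x xJ)) /= subrr.
Qed.

Lemma GV1 : exists J : ideal, GV J.
Proof.
pose J : ideal := span (fun _ : 'I_1 => 1 : R^o).
have J1 x : x \in J.
  by apply/asboolP; exists (fun=> x); rewrite big_ord1; exact: (esym (mulr1 x)).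
exists J; apply/GVE; split; first by exists 1%N, (fun=> 1).
  by move=> r /(_ 1 (J1 _)); rewrite mulr1.
move=> f lf; pose u : subMod J := exist _ (1 : R^o) (J1 1).
exists (f u) => x.
pose F : {linear subMod J -> R^o} :=
  HB.pack f (GRing.isLinear.Build R _ _ _ f lf).
have xE : x = (val x : R) *: u by apply: val_inj; exact: (esym (mulr1 _)).
by rewrite {1}xE -[f]/(F : _ -> _) linearZ mulrC.
Qed.

Lemma sum_span n (v : 'I_n -> R^o) (r : R) :
  (forall i, r * v i = 0) -> forall x, x \in span v -> r * x = 0.
Proof.
move=> rv x /asboolP[a ->]; rewrite mulr_sumr big1 // => i _.
by rewrite [a i *: _]/(a i * _) mulrCA rv mulr0.
Qed.

Lemma mem_span n (v : 'I_n -> R^o) i : v i \in span v.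
Proof.
apply/asboolP; exists (fun j => (j == i)%:R).
rewrite (bigD1 i) //= eqxx scale1r big1 ?addr0 // => j /negbTE ->.
by rewrite scale0r.
Qed.

(* GV(R) is downward directed: the product of two GV-ideals is a GV-ideal. *)
Lemma GV_meet (I J : ideal) : GV I -> GV J ->
  exists2 L : ideal, GV L & forall x, x \in L -> (x \in I) && (x \in J).
Proof.
move=> /GVE[[n [d dI]] injI surI] /GVE[[m [e eJ]] injJ surJ].
pose w (k : 'I_#|{: 'I_n * 'I_m}|) : R^o :=
  d (enum_val k).1 * e (enum_val k).2.
pose L : ideal := span w; have wE i j : exists k, w k = d i * e j.
  by exists (enum_rank (i, j)); rewrite /w enum_rankK.
have dI' i : d i \in I by rewrite dI mem_span.
have eJ' j : e j \in J by rewrite eJ mem_span.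
have prodL x y : x \in I -> y \in J -> (x * y : R^o) \in L.
  rewrite dI eJ => /asboolP[a ->] /asboolP[b ->].
  rewrite mulr_suml; apply: rpred_sum => i _; rewrite mulr_sumr.
  apply: rpred_sum => j _; have [k wk] := wE i j.
  suff <- : (a i * b j : R) *: w k = (a i * d i) * (b j * e j) :> R.
    by rewrite rpredZ ?mem_span.
  by rewrite wk -[LHS]/(_ * _ * (_ * _)) mulrACA.
exists L; last first.
  move=> x /asboolP[a ->]; apply/andP; split; apply: rpred_sum => k _;
    apply: rpredZ; rewrite /w; case: (enum_val k) => i j /=.
    by rewrite mulrC; apply: (@rpredZ _ _ I (e j) (d i)).
  exact: (@rpredZ _ _ J (d i) (e j)).
apply/GVE; split; first by exists _, w.
  move=> r rL; apply: injI => x xI; apply: injJ => y yJ.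
  by rewrite -mulrA; apply: rL; exact: prodL.
move=> f lf.
pose mulL x y (xI : x \in I) (yJ : y \in J) : subMod L :=
  exist _ (x * y : R^o) (prodL x y xI yJ).
have surI1 (x : subMod I) : exists r : R, forall y : subMod J,
    f (mulL _ _ (valP x) (valP y)) = r * val y.
  apply: surJ => a y z; rewrite -lf; congr f; apply: val_inj => /=.
  by rewrite mulrDr; congr (_ + _); rewrite -[a *: _]/(_ * _) mulrCA.
have [g gE] := choice surI1.
have glin : linear (g : subMod I -> R^o).
  move=> a x y; apply/eqP; rewrite -subr_eq0; apply/eqP; apply: injJ => z zJ.
  pose z' : subMod J := exist _ z zJ.
  have gz u : g u * z = f (mulL _ _ (valP u) (valP z')) by rewrite gE.
  rewrite mulrBl mulrDl -[(a *: (g x : R^o)) * z]mulrA !gz.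
  rewrite -[a * f _]/(a *: (f _ : R^o)) -lf; apply/eqP; rewrite subr_eq0.
  apply/eqP; congr f; apply: val_inj => /=.
  by rewrite mulrDl; congr (_ + _); rewrite -[LHS]mulrA.
have [r rE] := surI _ glin; exists r => x.
pose F : {linear subMod L -> R^o} :=
  HB.pack f (GRing.isLinear.Build R _ _ _ f lf).
have wL k : w k \in L by exact: mem_span.
have fw k : F (exist _ (w k) (wL k)) = r * w k.
  pose u : subMod I := exist (fun z => z \in I) _ (dI' (enum_val k).1).
  pose v : subMod J := exist (fun z => z \in J) _ (eJ' (enum_val k).2).
  have -> : exist _ (w k) (wL k) = mulL _ _ (valP u) (valP v) by exact: val_inj.
  by rewrite [LHS]gE rE [RHS]mulrA.
have /asboolP[a xE] := valP x.
have -> : x = \sum_k a k *: (exist _ (w k) (wL k) : subMod L).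
  apply: val_inj; rewrite [LHS]xE -[RHS]/(incl L _) linear_sum.
  by apply: eq_bigr => k _; rewrite [RHS]linearZ.
rewrite -[LHS]/(F _) -[val _]/(incl L _) [LHS]linear_sum.
rewrite [X in r * X]linear_sum mulr_sumr; apply: eq_bigr => k _.
rewrite [LHS]linearZ [X in r * X]linearZ [LHS]/(_ * _) fw.
exact: mulrCA.
Qed.

End GV.

Section GVTorsion.
Variable R : idomainType.

(* {x \in B | J x \subset A for some J \in GV(R)}; for A the image of M in its *)
(* injective envelope B this is M_w. *)
Definition w_closure (B : lmodType R) (A : submodClosed B) : {pred B} :=
  fun x => `[< exists2 J : ideal R, GV J & forall r, r \in J -> r *: x \in A >].

Lemma w_closure_closed (B : lmodType R) (A : submodClosed B) :
  submod_closed (w_closure A).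
Proof.
split=> [|a x y /asboolP[I GI Ix] /asboolP[J GJ Jy]]; apply/asboolP.
  by have [J GJ] := GV1 R; exists J => // r _; rewrite scaler0 rpred0.
have [L GL LIJ] := GV_meet GI GJ; exists L => // r /LIJ/andP[rI rJ].
rewrite scalerDr scalerA mulrC -scalerA.
by apply: rpredD; [apply: rpredZ; exact: Ix | exact: Jy].
Qed.
HB.instance Definition _ (B : lmodType R) (A : submodClosed B) :=
  GRing.isSubmodClosed.Build R B (w_closure A) (w_closure_closed A).

Definition tor_GV (M : lmodType R) : {pred M} :=
  fun x => `[< exists2 J : ideal R, GV J & forall r, r \in J -> r *: x = 0 >].

Lemma tor_GV_closed (M : lmodType R) : submod_closed (@tor_GV M).
Proof.
split=> [|a x y /asboolP[I GI Ix] /asboolP[J GJ Jy]]; apply/asboolP.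
  by have [J GJ] := GV1 R; exists J => // r _; rewrite scaler0.
have [L GL LIJ] := GV_meet GI GJ; exists L => // r /LIJ/andP[rI rJ].
by rewrite scalerDr scalerA mulrC -scalerA Ix // Jy // scaler0 addr0.
Qed.
HB.instance Definition _ (M : lmodType R) :=
  GRing.isSubmodClosed.Build R M (@tor_GV M) (tor_GV_closed M).

Definition GV_torsion (M : lmodType R) := forall x : M, x \in @tor_GV M.

Definition GV_torsion_free (M : lmodType R) :=
  forall x : M, x \in @tor_GV M -> x = 0.

End GVTorsion.

Arguments tor_GV {R} M.

Section WModules.
Variable R : idomainType.
Implicit Types M N E : lmodType R.

Definition injective_module E :=
  forall (A B : lmodType R) (i : {linear A -> B}) (f : {linear A -> E}),
    injective i -> exists g : {linear B -> E}, forall x, g (i x) = f x.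

Definition projective_module (P : lmodType R) :=
  forall (B C : lmodType R) (g : {linear B -> C}) (f : {linear P -> C}),
    surjective g -> exists h : {linear P -> B}, forall x, g (h x) = f x.

Definition essential M E (i : {linear M -> E}) :=
  forall S : submodClosed E,
    (forall x, i x \in S -> i x = 0) -> forall y, y \in S -> y = 0.

Definition injective_envelope M E (i : {linear M -> E}) :=
  [/\ injective_module E, injective i & essential i].

(* M_w, computed in the injective envelope i : M -> E *)
Definition w_envelope M E (i : {linear M -> E}) := subMod (w_closure (image i)).
HB.instance Definition _ M E (i : {linear M -> E}) :=
  GRing.SubLmodule.on (w_envelope i).

(* Injective envelopes exist and are unique up to isomorphism over M, so *)
(* "some envelope" below means "the envelope E(M)". *)
Definition w_module M :=
  GV_torsion_free M /\
  exists (E : lmodType R) (i : {linear M -> E}),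
    injective_envelope i /\ w_closure (image i) =i image i.

Definition w_ideal (I : ideal R) := w_module (subMod I).

Definition augmentation M (D : {freeg M / R}) : M := fglift id D.

Lemma fglift_linear (K : choiceType) M (f : K -> M) :
  linear (fglift f : {freeg K / R} -> M).
Proof.
have fgB := @lift_is_additive R K M f.
have fg0 : fglift f (0 : {freeg K / R}) = 0.
  by rewrite -(subrr (0 : {freeg K / R})) fgB subrr.
have fgD : {morph (fglift f : {freeg K / R} -> M) : x y / x + y}.
  by move=> x y; rewrite -{1}[y]opprK fgB -[- y]sub0r fgB fg0 sub0r opprK.
move=> a x y; rewrite fgD; congr (_ + _).
rewrite [a *: x]/(fgscale a x) /fgscale -[X in a *: fglift f X]freeg_sumE.
rewrite !(big_morph _ fgD fg0) scaler_sumr.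
by apply: eq_bigr => k _; rewrite !liftU scalerA.
Qed.

HB.instance Definition _ (K : choiceType) M (f : K -> M) :=
  GRing.isLinear.Build R {freeg K / R} M _ (fglift f) (fglift_linear f).
HB.instance Definition _ M := GRing.isLinear.Build R {freeg M / R} M _
  (@augmentation M) (fglift_linear id).

(* Ext^1(L, N) is the cokernel of Hom(P, N) -> Hom(K, N), computed from the *)
(* canonical free presentation 0 -> K -> P -> L -> 0 where P is free on the *)
(* underlying set of L. *)
Definition relations (L : lmodType R) := subMod (kernel (@augmentation L)).
HB.instance Definition _ (L : lmodType R) := GRing.SubLmodule.on (relations L).

Lemma restriction_subproof (L N : lmodType R) (h : Hom {freeg L / R} N) :
  linear (fun x : relations L => val h (val x)).
Proof. by move=> a x y; rewrite linearP (val_Hom_linear h). Qed.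

Definition restriction (L N : lmodType R) (h : Hom {freeg L / R} N) :
  Hom (relations L) N := mkHom (restriction_subproof h).

Lemma restriction_linear (L N : lmodType R) : linear (@restriction L N).
Proof. by move=> a g h; apply: val_inj. Qed.
HB.instance Definition _ (L N : lmodType R) :=
  GRing.isLinear.Build R _ _ _ (@restriction L N) (@restriction_linear L N).

Definition Ext1 (L N : lmodType R) := quotMod (image (@restriction L N)).
HB.instance Definition _ (L N : lmodType R) := GRing.Lmodule.on (Ext1 L N).

Definition w_projective M :=
  exists (E : lmodType R) (i : {linear quotMod (tor_GV M) -> E}),
    injective_envelope i /\
    forall N, torsion_free N -> w_module N ->
      GV_torsion (Ext1 (w_envelope i) N).

End WModules.

Section Localization.
Variables (R : idomainType) (p : prime_idealr R).

Definition denom := {s : R | s \notin p}.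
HB.instance Definition _ := Choice.on denom.

Lemma notin_mul (s t : R) : s \notin p -> t \notin p -> s * t \notin p.
Proof. by rewrite prime_idealrM negb_or => -> ->. Qed.

Lemma notin1 : (1 : R) \notin p.
Proof. by rewrite idealr1. Qed.

Definition dmul (s t : denom) : denom :=
  exist _ (val s * val t) (notin_mul (valP s) (valP t)).
Definition done1 : denom := exist _ 1 notin1.

Section Module.
Variable M : lmodType R.

Definition frac_equiv (u v : M * denom) :=
  `[< exists2 t : R, t \notin p & t *: (val v.2 *: u.1 - val u.2 *: v.1) = 0 >].

Lemma frac_equivP (u v : M * denom) :
  reflect
    (exists2 t : R, t \notin p & (t * val v.2) *: u.1 = (t * val u.2) *: v.1)
    (frac_equiv u v).
Proof.
apply: (iffP (asboolP _)) => -[t tp tE]; exists t => //.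
  by apply/eqP; rewrite -subr_eq0 -!scalerA -scalerBr tE.
by rewrite scalerBr !scalerA tE subrr.
Qed.

Lemma frac_equiv_refl : reflexive frac_equiv.
Proof. by move=> u; apply/frac_equivP; exists 1; rewrite ?notin1. Qed.

Lemma frac_equiv_sym : symmetric frac_equiv.
Proof.
by move=> u v; apply/frac_equivP/frac_equivP => -[t tp tE]; exists t.
Qed.

Lemma frac_equiv_trans : transitive frac_equiv.
Proof.
move=> v u w /frac_equivP[t tp tE] /frac_equivP[s sp sE]; apply/frac_equivP.
exists (t * s * val v.2); first by rewrite !notin_mul ?(valP v.2).
have -> : t * s * val v.2 * val w.2 = (s * val w.2) * (t * val v.2) by ring.
rewrite -scalerA tE scalerA.
have -> : s * val w.2 * (t * val u.2) = (t * val u.2) * (s * val w.2) by ring.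
by rewrite -scalerA sE scalerA; congr (_ *: _); rewrite /=; ring.
Qed.

Canonical frac_equiv_rel :=
  EquivRel frac_equiv frac_equiv_refl frac_equiv_sym frac_equiv_trans.
Canonical frac_equiv_direct := defaultEncModRel frac_equiv.

Definition localization := {eq_quot frac_equiv}.
HB.instance Definition _ := Choice.on localization.
HB.instance Definition _ := EqQuotient.on localization.

Definition frac (x : M) (s : denom) : localization := \pi_localization (x, s).

Lemma fracP x s y t : reflect
  (exists2 c : R, c \notin p & (c * val t) *: x = (c * val s) *: y)
  (frac x s == frac y t).
Proof.
apply: (equivP eqP); split=> [/eqmodP/frac_equivP//|H].
exact/eqmodP/frac_equivP.
Qed.

Lemma fracE (a : localization) : exists x s, a = frac x s.
Proof.
by exists (repr a).1, (repr a).2; rewrite /frac -surjective_pairing reprK.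
Qed.

Let ladd (a b : localization) : localization :=
  frac (val (repr b).2 *: (repr a).1 + val (repr a).2 *: (repr b).1)
       (dmul (repr a).2 (repr b).2).
Let lzero : localization := frac 0 done1.
Let lopp (a : localization) : localization := frac (- (repr a).1) (repr a).2.
Let lscale (r : R) (a : localization) : localization :=
  frac (r *: (repr a).1) (repr a).2.

Lemma repr_frac x s : exists2 c : R, c \notin p &
  (c * val s) *: (repr (frac x s)).1 = (c * val (repr (frac x s)).2) *: x.
Proof.
by apply/fracP; rewrite /frac -surjective_pairing reprK.
Qed.

Let laddE x s y t :
  ladd (frac x s) (frac y t) = frac (val t *: x + val s *: y) (dmul s t).
Proof.
have [c cp cE] := repr_frac x s; have [d dp dE] := repr_frac y t.
apply/eqP/fracP; exists (c * d); first exact: notin_mul.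
move: (repr (frac x s)) (repr (frac y t)) cE dE => [x' s'] [y' t'] /= cE dE.
rewrite !scalerDr !scalerA /=; congr (_ + _).
  have -> : c * d * (val s * val t) * val t' =
      (d * val t * val t') * (c * val s).
    by ring.
  by rewrite -scalerA cE scalerA; congr (_ *: _); rewrite /=; ring.
have -> : c * d * (val s * val t) * val s' = (c * val s * val s') * (d * val t).
  by ring.
by rewrite -scalerA dE scalerA; congr (_ *: _); rewrite /=; ring.
Qed.

Let loppE x s : lopp (frac x s) = frac (- x) s.
Proof.
have [c cp cE] := repr_frac x s; apply/eqP/fracP; exists c => //.
by rewrite !scalerN cE.
Qed.

Let lscaleE r x s : lscale r (frac x s) = frac (r *: x) s.
Proof.
have [c cp cE] := repr_frac x s; apply/eqP/fracP; exists c => //.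
have -> : (c * val s) *: (r *: (repr (frac x s)).1) =
    r *: ((c * val s) *: (repr (frac x s)).1).
  by rewrite !scalerA mulrC.
by rewrite cE !scalerA; congr (_ *: _); rewrite /=; ring.
Qed.

Let laddA : associative ladd.
Proof.
move=> a b c; have [x [s ->]] := fracE a; have [y [t ->]] := fracE b.
have [z [u ->]] := fracE c; rewrite (laddE y) (laddE x s y) !laddE /=.
apply/eqP/fracP; exists 1; rewrite ?notin1 //= !scalerDr !scalerA addrA.
by congr (_ *: _ + _ *: _ + _ *: _); rewrite /=; ring.
Qed.

Let laddC : commutative ladd.
Proof.
move=> a b; have [x [s ->]] := fracE a; have [y [t ->]] := fracE b.
rewrite (laddE x) (laddE y) addrC.
by apply/eqP/fracP; exists 1; rewrite ?notin1 //= [val t * _]mulrC.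
Qed.

Let ladd0 : left_id lzero ladd.
Proof.
move=> a; have [x [s ->]] := fracE a; rewrite laddE scaler0 add0r.
apply/eqP/fracP; exists 1; rewrite ?notin1 //= scalerA.
by congr (_ *: _); rewrite /=; ring.
Qed.

Let laddN : left_inverse lzero lopp ladd.
Proof.
move=> a; have [x [s ->]] := fracE a; rewrite loppE laddE scalerN addNr.
by apply/eqP/fracP; exists 1; rewrite ?notin1 // !scaler0.
Qed.

HB.instance Definition _ :=
  GRing.isZmodule.Build localization laddA laddC ladd0 laddN.

Let lscaleA a b q : lscale a (lscale b q) = lscale (a * b) q.
Proof. by have [x [s ->]] := fracE q; rewrite (lscaleE b) !lscaleE scalerA. Qed.
Let lscale1 : left_id 1 lscale.
Proof. by move=> q; have [x [s ->]] := fracE q; rewrite lscaleE scale1r. Qed.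
Let lscaleDr : right_distributive lscale ladd.
Proof.
move=> a q r; have [x [s ->]] := fracE q; have [y [t ->]] := fracE r.
rewrite (laddE x) !lscaleE laddE; congr frac.
by rewrite scalerDr !scalerA; congr (_ *: _ + _ *: _); rewrite /=; ring.
Qed.
Let lscaleDl q a b : lscale (a + b) q = ladd (lscale a q) (lscale b q).
Proof.
have [x [s ->]] := fracE q; rewrite !lscaleE laddE.
apply/eqP/fracP; exists 1; rewrite ?notin1 //= -scalerDr -scalerDl !scalerA.
by congr (_ *: _); rewrite /=; ring.
Qed.

HB.instance Definition _ := GRing.Zmodule_isLmodule.Build R localization
  lscaleA lscale1 lscaleDr lscaleDl.

Lemma addfE x s y t :
  frac x s + frac y t = frac (val t *: x + val s *: y) (dmul s t).
Proof. exact: laddE. Qed.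

Lemma scalefE r x s : r *: frac x s = frac (r *: x) s.
Proof. exact: lscaleE. Qed.

End Module.

Section Map.
Variables (M N : lmodType R) (f : {linear M -> N}).

(* Computed on a representative; loc_mapE is x / s |-> f x / s. *)
Definition loc_map (a : localization M) : localization N :=
  frac (f (repr a).1) (repr a).2.

Let fZ c x : f (c *: x) = c *: f x.
Proof. exact: linearZ_LR. Qed.

Lemma loc_mapE x s : loc_map (frac x s) = frac (f x) s.
Proof.
have [c cp cE] := repr_frac x s; apply/eqP/fracP; exists c => //.
by move/(congr1 f): cE; rewrite !fZ.
Qed.

Lemma loc_map_linear : linear loc_map.
Proof.
move=> r a b; have [x [s ->]] := fracE a; have [y [t ->]] := fracE b.
rewrite scalefE addfE !loc_mapE scalefE addfE; congr frac.
by rewrite linearD !fZ.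
Qed.
HB.instance Definition _ :=
  GRing.isLinear.Build R _ _ _ loc_map loc_map_linear.

End Map.
End Localization.

Arguments loc_map {R} p {M N} f.

Section Tensor.
Variables (R : idomainType) (N : lmodType R).

Section Product.
Variable A : lmodType R.

Local Notation free := {freeg (N * A)%type / R}.

Definition bilinear_relations : set free := fun D => exists r n n' a a',
  [\/ D = << (n + n', a) >> - << (n, a) >> - << (n', a) >>,
      D = << (n, a + a') >> - << (n, a) >> - << (n, a') >>,
      D = << (r *: n, a) >> - r *: << (n, a) >>
    | D = << (n, r *: a) >> - r *: << (n, a) >>].

Definition tensor := quotMod (generated bilinear_relations).
HB.instance Definition _ := GRing.Lmodule.on tensor.

Definition pure_tensor (n : N) (a : A) : tensor :=
  qproj _ (<< (n, a) >> : free).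

Let relation0 D :
  bilinear_relations D -> qproj (generated bilinear_relations) D = 0.
Proof.
move=> XD; rewrite -(linear0 (qproj (generated bilinear_relations))).
by apply/quotModP; rewrite subr0; apply/asboolP => S; apply.
Qed.

Lemma pure_tensorDl n n' a :
  pure_tensor (n + n') a = pure_tensor n a + pure_tensor n' a.
Proof.
apply/eqP; rewrite -subr_eq0 opprD addrA -!linearB; apply/eqP/relation0.
by exists 0, n, n', a, 0; constructor 1.
Qed.

Lemma pure_tensorDr n a a' :
  pure_tensor n (a + a') = pure_tensor n a + pure_tensor n a'.
Proof.
apply/eqP; rewrite -subr_eq0 opprD addrA -!linearB; apply/eqP/relation0.
by exists 0, n, 0, a, a'; constructor 2.
Qed.

Lemma pure_tensorZl r n a : pure_tensor (r *: n) a = r *: pure_tensor n a.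
Proof.
apply/eqP; rewrite -subr_eq0 -linearZ_LR -linearB; apply/eqP/relation0.
by exists r, n, 0, a, 0; constructor 3.
Qed.

Lemma pure_tensorZr r n a : pure_tensor n (r *: a) = r *: pure_tensor n a.
Proof.
apply/eqP; rewrite -subr_eq0 -linearZ_LR -linearB; apply/eqP/relation0.
by exists r, n, 0, a, 0; constructor 4.
Qed.

End Product.

Section Map.
Variables (A B : lmodType R) (f : {linear A -> B}).

Let g (D : {freeg (N * A)%type / R}) : tensor B :=
  fglift (fun na => pure_tensor na.1 (f na.2)) D.

Let g_linear : linear g. Proof. exact: fglift_linear. Qed.

HB.instance Definition _ := GRing.isLinear.Build R _ _ _ g g_linear.

(* Computed on a representative; tensor_mapE is n (x) a |-> n (x) f a. *)
Definition tensor_map (t : tensor A) : tensor B := g (repr t).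

Let g_relation D : D \in generated (@bilinear_relations A) -> g D = 0.
Proof.
move=> /asboolP/(_ (kernel g)) gD; apply/eqP; apply: gD => {}D.
case=> r [n [n' [a [a']]]] D_rel; apply/eqP.
have gU m b : g << (m, b) >> = pure_tensor m (f b).
  by rewrite /g liftU scale1r.
have gZ m b : g (r *: << (m, b) >>) = r *: pure_tensor m (f b).
  by rewrite -gU; exact: linearZ_LR.
case: D_rel => ->; rewrite !linearB /= ?gZ !gU.
- by rewrite pure_tensorDl addrAC addrK subrr.
- by rewrite linearD pure_tensorDr addrAC addrK subrr.
- by rewrite pure_tensorZl subrr.
- by rewrite linearZ_LR pure_tensorZr subrr.
Qed.

Lemma tensor_map_qproj D : tensor_map (qproj _ D) = g D.
Proof.
apply/eqP; rewrite -subr_eq0 -linearB; apply/eqP/g_relation/quotModP.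
by rewrite reprK.
Qed.

Lemma tensor_mapE n a : tensor_map (pure_tensor n a) = pure_tensor n (f a).
Proof. by rewrite tensor_map_qproj /g liftU scale1r. Qed.

Lemma tensor_map_linear : linear tensor_map.
Proof.
move=> r x y.
have [D ->] : exists D, x = qproj _ D by exists (repr x); rewrite /qproj reprK.
have [D' ->] : exists D', y = qproj _ D'.
  by exists (repr y); rewrite /qproj reprK.
by rewrite -linearP !tensor_map_qproj linearP.
Qed.
HB.instance Definition _ :=
  GRing.isLinear.Build R _ _ _ tensor_map tensor_map_linear.

End Map.
End Tensor.

Arguments tensor_map {R} N {A B} f.

Section WExactness.
Variable R : idomainType.

Definition exact_seq (A B C : lmodType R)
    (f : {linear A -> B}) (g : {linear B -> C}) :=
  forall y, g y = 0 <-> exists x, f x = y.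

Definition short_exact (A B C : lmodType R)
    (f : {linear A -> B}) (g : {linear B -> C}) :=
  [/\ injective f, exact_seq f g & surjective g].

Definition w_Max (m : ideal R) :=
  [/\ w_ideal m, (1 : R^o) \notin m &
    forall I : ideal R, w_ideal I -> (1 : R^o) \notin I ->
      {subset m <= I} -> I =i m].

Definition prime_ideal (p : prime_idealr R) : {pred R^o} :=
  fun x => (x : R) \in p.

Lemma prime_ideal_closed p : submod_closed (prime_ideal p).
Proof.
split=> [|a x y xp yp]; first exact: (rpred0 p).
by apply: (@rpredD _ p) => //; exact: (idealMr (idealrI := p)).
Qed.
HB.instance Definition _ p :=
  GRing.isSubmodClosed.Build R R^o (prime_ideal p) (prime_ideal_closed p).

(* Localization is only defined at primes; as every member of w-Max(R) is *)
(* prime, the quantifications below range over all of w-Max(R). *)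

Definition w_epimorphism (A B : lmodType R) (f : {linear A -> B}) :=
  forall p : prime_idealr R, w_Max (prime_ideal p) -> surjective (loc_map p f).

Definition w_short_exact (A B C : lmodType R)
    (f : {linear A -> B}) (g : {linear B -> C}) :=
  forall p : prime_idealr R, w_Max (prime_ideal p) ->
    short_exact (loc_map p f) (loc_map p g).

Definition w_finitely_generated (M : lmodType R) :=
  exists n (f : {linear 'rV[R]_n -> M}), w_epimorphism f.

Definition w_pure (A B C : lmodType R)
    (f : {linear A -> B}) (g : {linear B -> C}) :=
  short_exact f g /\
  forall N : lmodType R, w_short_exact (tensor_map N f) (tensor_map N g).

Definition w_pure_submodule (M : lmodType R) (S : submodClosed M) :=
  w_pure (incl S) (qproj S).

Definition w_split (A B C : lmodType R)
    (f : {linear A -> B}) (g : {linear B -> C}) :=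
  short_exact f g /\
  exists n (d : 'I_n -> R^o) (h : 'I_n -> {linear C -> B}),
    GV (span d) /\ forall k x, g (h k x) = (d k : R) *: x.

Definition w_split_module (M : lmodType R) :=
  exists (L P : lmodType R) (f : {linear L -> P}) (g : {linear P -> M}),
    projective_module P /\ w_split f g.

End WExactness.

Arguments w_finitely_generated {R} M.
Arguments w_split_module {R} M.
Arguments w_projective {R} M.

(* An alias of {fraction R}, to carry the R-module structure. *)
Definition quotient_field (R : idomainType) : Type := {fraction R}.

Section PvMD.
Variable R : idomainType.
Local Notation K := (quotient_field R).

HB.instance Definition _ := GRing.Field.on K.

Let kscale (r : R) (x : K) : K := tofrac r * x.
Let kscaleA a b x : kscale a (kscale b x) = kscale (a * b) x.
Proof. by rewrite /kscale rmorphM mulrA. Qed.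
Let kscale1 : left_id 1 kscale.
Proof. by move=> x; rewrite /kscale rmorph1 mul1r. Qed.
Let kscaleDr : right_distributive kscale +%R.
Proof. by move=> a x y; rewrite /kscale mulrDr. Qed.
Let kscaleDl x : {morph kscale^~ x : a b / a + b}.
Proof. by move=> a b; rewrite /kscale rmorphD mulrDl. Qed.
HB.instance Definition _ := GRing.Zmodule_isLmodule.Build R K
  kscaleA kscale1 kscaleDr kscaleDl.

Definition in_R (x : K) := exists r : R, x = tofrac r.

Definition inverse_ideal (I : ideal R) : set K :=
  [set x | forall a : R, a \in I -> in_R (a *: x)].

Definition mul_inverse (I : ideal R) : {pred K} :=
  generated
    [set y : K | exists a x, [/\ a \in I, inverse_ideal I x & y = a *: x]].
HB.instance Definition _ I := GRing.SubmodClosed.on (mul_inverse I).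

(* K is the injective envelope of the nonzero R-submodule I I^-1 of K. *)
Definition w_invertible (I : ideal R) :=
  forall x : K, x \in w_closure (mul_inverse I) <-> in_R x.

Definition PvMD := forall I : ideal R,
  fg_sub I -> (exists2 a : R, a != 0 & a \in I) -> w_invertible I.

End PvMD.

(* Main.v *)
(* Everything is equivalent to a local condition: for every maximal w-ideal p  *)
(* and all a, b in R, some u outside p makes ua a multiple of b or ub a        *)
(* multiple of a, i.e. R_p is a valuation domain. Passing between local and    *)
(* global relies on one fact, a consequence of Zorn's lemma: an ideal          *)
(* contained in no maximal w-ideal contains a GV-ideal.                        *)
(* Under the local condition, a generating family v of a torsion-free module   *)
(* N can be thinned, away from p, to a free one; so u Id_N factors through     *)
(* R^n for some u outside p. The d for which d Id_N factors through R^n form   *)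
(* an ideal, which therefore contains a GV-ideal. The factorizations lift to   *)
(* any module mapping onto N, which gives the w-splittings, kill Ext^1, which  *)
(* gives w-projectivity, and retract finitely generated modules onto their     *)
(* torsion up to u, which gives purity.                                        *)
(* Conversely, take an ideal (a, b) with a <> 0 and relation module L. Purity  *)
(* of L / aL in R^2 / aL, tested on R / (a, b), puts (b, -a) into aL + bL near *)
(* p; w-projectivity of (a, b) splits the free presentation of (a, b)_w up to  *)
(* an element outside p. Either way the local condition can be read off.       *)

Require Import Defs.
From HB Require Import structures.
From mathcomp Require Import all_boot all_algebra.
From mathcomp Require Import boolp classical_sets functions.
From mathcomp Require Import freeg ring.
Import Defs.

Set Implicit Arguments.
Unset Strict Implicit.
Unset Printing Implicit Defensive.

Import GRing.Theory.
Local Open Scope ring_scope.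

(** The hinge is [w_valuation]. For a nonzero finitely generated ideal I, 1 lies in (I I^-1)_w
    exactly when no maximal w-ideal contains I I^-1, that is, when every I_p is principal; over R_p
    this amounts to one generator dividing all the others. Hence [PvMD_valuation] and
    [valuation_PvMD].

    Under the local condition, [w_splitting] yields a GV-ideal whose generators, as multiples of the
    identity of a torsion-free module w-generated by n elements, factor through R^n. From it follow
    [valuation_w_split], [valuation_w_split_module] and [valuation_w_projective]. For an arbitrary
    M, [valuation_w_pure] combines the local retraction [local_torsion_retraction] with the
    reduction to finitely generated submodules in [tensor_vanish_finite].

    There are two ways back to the local condition, [w_pure_valuation] and [w_projective_valuation].
    The w-split conditions join the first one: w-split sequences are w-pure ([w_split_w_pure]), and
    a w-split module M/T(M) has a w-split canonical sequence because the projective module over it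
    lifts to M. *)

(** * Submodules, linear maps and torsion *)

Section Modules.
Variable R : idomainType.
Implicit Types M N U V : lmodType R.

(** Turns a propositional predicate into a bundled submodule by classical reflection; conductors,
    ideals of multipliers and the like are all built this way. *)
Lemma ex_submod M (P : M -> Prop) :
  P 0 -> (forall a u v, P u -> P v -> P (a *: u + v)) ->
  exists S : submodClosed M, forall x, x \in S <-> P x.
Proof.
move=> P0 PD; pose p : {pred M} := fun x => `[< P x >].
have pcl : submod_closed p.
  by split=> [|a u v /asboolP Pu /asboolP Pv]; apply/asboolP => //; exact: PD.
pose S : submodClosed M :=
  HB.pack p (GRing.isSubmodClosed.Build R M p pcl).
by exists S => x; split=> /asboolP.
Qed.

Lemma ex_linear U V (f : U -> V) :
  linear f -> exists g : {linear U -> V}, g =1 f.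
Proof.
move=> lf; pose g : {linear U -> V} :=
  HB.pack f (GRing.isLinear.Build R _ _ _ f lf).
by exists g.
Qed.

Lemma linear_zero U V : exists z : {linear U -> V}, forall x, z x = 0.
Proof. by apply: ex_linear => a x y; rewrite scaler0 addr0. Qed.

Lemma ex_prime_ideal (P : R -> Prop) : P 0 -> ~ P 1 ->
  (forall a u v, P u -> P v -> P (a * u + v)) ->
  (forall u v, P (u * v) -> P u \/ P v) ->
  exists p : prime_idealr R, forall x, x \in p <-> P x.
Proof.
move=> P0 P1 PD PM; pose p : {pred R} := fun x => `[< P x >].
have pcl : idealr_closed p.
  split=> [||a u v /asboolP Pu /asboolP Pv]; try exact/asboolP.
  by apply/asboolP; exact: PD.
have ppr : prime_idealr_closed p.
  by move=> u v /asboolP/PM[Pu|Pv]; apply/orP; [left|right]; apply/asboolP.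
have pZ := GRing.isZmodClosed.Build R p (idealr_closedB pcl).
have pI := isProperIdeal.Build R p (idealr_closed_nontrivial pcl).
have pP := isPrimeIdealrClosed.Build R p ppr.
pose S : prime_idealr R := HB.pack p pZ pI pP.
by exists S => x; split=> /asboolP.
Qed.

Lemma span_subset M n (v : 'I_n -> M) (S : submodClosed M) :
  (forall i, v i \in S) -> {subset span v <= S}.
Proof.
by move=> vS x /asboolP[a ->]; apply: rpred_sum => i _; exact: rpredZ.
Qed.

Lemma span_mem M n (v : 'I_n -> M) i : v i \in span v.
Proof.
apply/asboolP; exists (fun j => (j == i)%:R).
rewrite (bigD1 i) //= eqxx scale1r big1 ?addr0 // => j /negbTE ->.
by rewrite scale0r.
Qed.

Lemma torsion_free_scale M (r : R) (x : M) :
  torsion_free M -> r *: x = 0 -> r = 0 \/ x = 0.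
Proof.
move=> tfM rx; have [->|r0] := eqVneq r 0; [by left | right].
by apply: tfM; apply/asboolP; exists r.
Qed.

Lemma torsion_free_inj M (r : R) (x y : M) :
  torsion_free M -> r != 0 -> r *: x = r *: y -> x = y.
Proof.
move=> tfM r0 /eqP; rewrite -subr_eq0 -scalerBr => /eqP.
by case/(torsion_free_scale tfM) => [/eqP|/eqP];
  rewrite ?(negbTE r0) // subr_eq0 => /eqP.
Qed.

Lemma torsion_free_sub M (S : submodClosed M) :
  torsion_free M -> torsion_free (subMod S).
Proof.
move=> tfM x /asboolP[r r0 rx]; apply: val_inj; apply: tfM; apply/asboolP.
by exists r => //; move/(congr1 val): rx.
Qed.

Lemma qproj_surj M (S : submodClosed M) : surjective (qproj S).
Proof. by move=> q; exists (repr q); rewrite /qproj reprK. Qed.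

Lemma torsion_free_quot M : torsion_free (quotMod (torsion M)).
Proof.
move=> q /asboolP[r r0]; have [x <-] := qproj_surj q;
  rewrite -linearZ_LR -(linear0 (qproj (torsion M))) => /quotModP.
rewrite subr0 => /asboolP[s s0 srx]; apply/quotModP; rewrite subr0.
by apply/asboolP; exists (s * r); rewrite ?mulf_neq0 // -scalerA.
Qed.

Lemma torsion_free_regular : torsion_free R^o.
Proof.
move=> x /asboolP[r r0 /eqP].
by rewrite -[_ *: _]/(r * x) mulf_eq0 (negbTE r0) => /eqP.
Qed.

Lemma qproj_eq0 M (S : submodClosed M) x : qproj S x = 0 <-> x \in S.
Proof.
rewrite -(linear0 (qproj S)); split=> [/quotModP|xS]; first by rewrite subr0.
by apply/quotModP; rewrite subr0.
Qed.

Lemma incl_inj M (S : submodClosed M) : injective (incl S).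
Proof. exact: val_inj. Qed.

Lemma short_exact_quot M (S : submodClosed M) :
  short_exact (incl S) (qproj S).
Proof.
split; first exact: incl_inj; last exact: qproj_surj.
move=> y; split=> [/qproj_eq0 yS|[x <-]]; first by exists (exist _ y yS).
by apply/qproj_eq0; exact: (valP x).
Qed.

End Modules.

(** * GV-ideals *)

Section GVIdeals.
Variable R : idomainType.
Implicit Types (I J L : ideal R) (a b r : R).

Lemma idealM I a (x : R^o) : x \in I -> (a * x : R) \in I.
Proof. exact: rpredZ. Qed.

(* The homomorphisms J -> R are the multiplications by the elements of         *)
(* J^-1 \subset K, so J is a GV-ideal when a fraction a / b with               *)
(* J (a / b) \subset R belongs to R.                                           *)
Lemma GVP J : GV J <->
  [/\ fg_sub J, exists2 j : R, (j : R^o) \in J & j != 0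
    & forall a b, b != 0 ->
      (forall j : R, (j : R^o) \in J -> exists c, j * a = c * b) ->
      exists c, a = c * b].
Proof.
split=> [/GVE[fgJ injJ surJ]|[fgJ [k kJ k0] divJ]].
  have [k kJ k0] : exists2 j : R, (j : R^o) \in J & j != 0.
    apply: contrapT => nJ; have /eqP := oner_neq0 R; apply; apply: injJ => x xJ.
    by rewrite mul1r; apply: contrapT => /eqP x0; apply: nJ; exists x.
  split=> // [|a b b0 Jab]; first by exists k.
  have /choice[f fE] : forall x : subMod J, exists c, (val x : R) * a = c * b.
    by move=> x; apply: Jab; exact: (valP x).
  have lf : linear (f : subMod J -> R^o).
    move=> c x y; apply: (mulIf b0); rewrite -fE.
    rewrite -[LHS]/((c * val x + val y) * a) -[RHS]/((c * f x + f y) * b).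
    by rewrite !mulrDl -!mulrA -!fE.
  have [c cE] := surJ f lf; exists c.
  have := fE (exist _ k kJ); rewrite cE /= => E.
  by apply: (mulfI k0); rewrite E -mulrA mulrCA.
apply/GVE; split=> // [r /(_ k kJ) /eqP|f lf].
  by rewrite mulf_eq0 (negbTE k0) orbF => /eqP.
have [F FE] := ex_linear lf.
(* Both sides are F (k x), so F is multiplication by the fraction F(k) / k. *)
have Fk (x : subMod J) : F x * k = val x * F (exist _ k kJ).
  rewrite [_ * k]mulrC -[LHS]/(k *: (F x : R^o)) -[RHS]/(val x *: (F _ : R^o)).
  by rewrite -!linearZ_LR; congr (F _); apply: val_inj; exact: mulrC.
have [j jJ|c cE] := divJ (F (exist _ k kJ)) k k0.
  by exists (F (exist _ j jJ)); rewrite Fk.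
exists c => x; rewrite -FE; apply: (mulIf k0); rewrite Fk cE.
by rewrite mulrA [val x * c]mulrC.
Qed.

Lemma GV_neq0 J : GV J -> exists2 j : R, (j : R^o) \in J & j != 0.
Proof. by case/GVP. Qed.

Lemma GV_fg J : GV J -> exists n (d : 'I_n -> R^o), J =i span d /\ GV (span d).
Proof.
move=> GJ; have [[n [d dJ]] [j jJ j0] divJ] := (GVP J).1 GJ.
exists n, d; split=> //; apply/GVP; split; first by exists n, d.
  by exists j; rewrite -?dJ.
by move=> a b b0 H; apply: divJ => // i iJ; apply: H; rewrite -dJ.
Qed.

(** L is the product I J. If a fraction q carries I J into R, then J (x q) lies in R for each x in
    I, so x q is in R, and then q is in R. *)
Lemma GV_mul I J : GV I -> GV J ->
  exists2 L, GV L & forall S : ideal R,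
    (forall x y : R, (x : R^o) \in I -> (y : R^o) \in J ->
      (x * y : R^o) \in S) ->
    {subset L <= S}.
Proof.
move=> /GVP[[n [d dI]] [i iI i0] divI] /GVP[[m [e eJ]] [j jJ j0] divJ].
pose w (k : 'I_#|{: 'I_n * 'I_m}|) : R^o := d (enum_val k).1 * e (enum_val k).2.
have wE k l : w (enum_rank (k, l)) = d k * e l by rewrite /w enum_rankK.
have prodL (x y : R) : (x : R^o) \in I -> (y : R^o) \in J ->
  (x * y : R^o) \in span w.
  rewrite dI eJ => /asboolP[a ->] /asboolP[b ->].
  rewrite mulr_suml; apply: rpred_sum => k _; rewrite mulr_sumr.
  apply: rpred_sum => l _.
  suff <- : (a k * b l : R) *: w (enum_rank (k, l)) =
    (a k * d k) * (b l * e l) :> R.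
    by rewrite rpredZ ?span_mem.
  by rewrite wE -[LHS]/(_ * _ * (_ * _)) mulrACA.
pose L : ideal R := span w; exists L => [|S H]; last first.
  by apply: span_subset => k; apply: H; rewrite ?dI ?eJ span_mem.
apply/GVP; split; first by exists _, w.
  by exists (i * j); rewrite ?mulf_neq0 ?prodL.
move=> a b b0 H; apply: divI => // x xI; apply: divJ => // y yJ.
by rewrite mulrA [y * x]mulrC; apply: H; exact: prodL.
Qed.

Lemma GV_full I : (1 : R^o) \in I -> exists2 J, GV J & {subset J <= I}.
Proof.
move=> I1; have [J GJ] := GV1 R; exists J => // x _.
by rewrite -[x]mulr1; exact: idealM.
Qed.

Definition avoids_GV I := forall J, GV J -> ~ {subset J <= I}.

(** Zorn's lemma applies because GV-ideals are finitely generated: one that lies in the union of a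
    chain lies in a member of it. *)
Lemma maximal_avoids_GV I : avoids_GV I ->
  exists m : ideal R, [/\ avoids_GV m, {subset I <= m} &
    forall L, avoids_GV L -> {subset m <= L} -> L =i m].
Proof.
(* The clauses hold for the empty set, as they must for the union of the empty chain; [A0] later
   shows, by comparison with I, that the maximal set is not empty. *)
move=> aI; pose P (X : set R^o) := [/\
  forall a u v, X u -> X v -> X (a *: u + v),
  forall x y, X x -> y \in I -> X (x + y) &
  forall J, GV J -> ~ forall x, x \in J -> X x].
have Pbig F : (F `<=` P)%classic -> total_on F subset ->
  P (\bigcup_(X in F) X)%classic.
  move=> FP Ftot.
  have join X Y : F X -> F Y -> exists2 Z, F Z & (X `<=` Z /\ Y `<=` Z)%classic.
    move=> FX FY; have [XY|YX] := Ftot _ _ FX FY; [exists Y | exists X] => //;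
      split=> // ?.
  split.
  - move=> a u v [X FX Xu] [Y FY Yv]; have [Z FZ [XZ YZ]] := join _ _ FX FY.
    by exists Z => //; have [H _ _] := FP _ FZ; apply: H;
      [apply: XZ | apply: YZ].
  - move=> x y [X FX Xx] yI; exists X => //.
    by have [_ H _] := FP _ FX; apply: H.
  move=> J GJ H; have [[n [d dJ]] [j jJ _] _] := (GVP J).1 GJ.
  have [Z0 FZ0 Z0j] := H j jJ.
  (* One member of the chain contains all generators of J; [j] makes it inhabited, so that it
     contains 0. *)
  have [Z [FZ Zj dZ]] : exists Z, [/\ F Z, Z j & forall i : 'I_n, Z (d i)].
    have dH i : exists2 X, F X & X (d i) by apply: H; rewrite dJ span_mem.
    have [s sH] : exists s : seq 'I_n, s = enum 'I_n by exists (enum 'I_n).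
    suff [Z [FZ Zj ZH]] : exists Z,
      [/\ F Z, Z j & forall i, i \in s -> Z (d i)].
      by exists Z; split=> // i; apply: ZH; rewrite sH mem_enum.
    elim: s {sH} => [|i s [Z [FZ Zj ZH]]]; first by exists Z0.
    have [X FX Xi] := dH i; have [Y FY [XY ZY]] := join _ _ FX FZ.
    exists Y; split=> // [|k]; first exact: ZY.
    by rewrite inE => /orP[/eqP->|/ZH/ZY//]; exact: XY.
  have [FZ1 _ FZ3] := FP _ FZ; apply: (FZ3 _ GJ) => x.
  have [S SE] : exists S : submodClosed R^o, forall x, x \in S <-> Z x.
    apply: ex_submod => //.
    by have := FZ1 (-1) j j Zj Zj; rewrite scaleN1r addNr.
  by rewrite dJ => /(span_subset (S := S)) xS; apply/SE/xS => i; apply/SE.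
have [A [[A1 A2 A3] Amax]] := Zorn_bigcup Pbig.
have PS (S : ideal R) : {subset I <= S} -> avoids_GV S -> P [set` S]%classic.
  move=> IS aS; split=> [a u v uS vS|x y xS yI|//];
    first by apply: (@rpredD _ S) => //; apply: (@rpredZ _ _ S).
  by apply: (@rpredD _ S) => //; exact: IS.
have A0 : A 0.
  have [x Ax] : exists x, A x.
    apply: contrapT => nA; have := Amax [set` I]%classic; apply; last exact: PS.
    split=> [x Ax|]; first by case: nA; exists x.
    by move/(_ 0 (rpred0 I)) => A0; case: nA; exists 0.
  by have := A1 (-1) x x Ax Ax; rewrite scaleN1r addNr.
have [m mE] := ex_submod A0 A1; exists m; split.
- by move=> J GJ Jm; apply: (A3 J GJ) => x /Jm /mE.
- by move=> y yI; apply/mE; rewrite -[y]add0r; exact: A2.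
move=> L aL mL x; apply/idP/idP => [xL|]; last exact: mL.
apply/mE; apply: contrapT => nAx; have := Amax [set` L]%classic; apply.
  by split=> [y /mE/mL//|H]; apply/nAx/H.
by apply: PS => // y yI; apply/mL/mE; rewrite -[y]add0r; exact: A2.
Qed.

(* If I and J are GV-ideals with I in m + Rx and J in m + Ry, and xy lies in   *)
(* m, then IJ lies in m.                                                       *)
Lemma maximal_avoids_GV_prime (m : ideal R) : avoids_GV m ->
  (forall L, avoids_GV L -> {subset m <= L} -> L =i m) ->
  exists p : prime_idealr R, prime_ideal p =i m.
Proof.
move=> am maxm.
have adj x : exists S : ideal R, forall y, y \in S <->
    exists a (z : R^o), z \in m /\ y = a * x + z.
  apply: ex_submod => [|c _ _ [a [u [um ->]]] [b [v [vm ->]]]].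
    by exists 0, 0; rewrite rpred0 mul0r addr0.
  exists (c * a + b), (c *: u + v); split; first by rewrite rpredD ?rpredZ.
  rewrite -[LHS]/(c * (a * x + u) + (b * x + v))
    -[RHS]/((c * a + b) * x + (c * u + v)).
  ring.
have GVx x : (x : R^o) \notin m -> exists2 J, GV J &
    forall y : R, (y : R^o) \in J ->
      exists a (z : R^o), z \in m /\ y = a * x + z.
  move=> xm; have [S SE] := adj x; apply: contrapT => nJ.
  have mS : {subset m <= S}.
    by move=> y ym; apply/SE; exists 0, y; rewrite mul0r add0r.
  have /maxm : avoids_GV S.
    by move=> J GJ JS; apply: nJ; exists J => // y /JS/SE.
  move=> /(_ mS x); rewrite (negbTE xm) => /negbT/negP; apply.
  by apply/SE; exists 1, 0; rewrite rpred0 mul1r addr0.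
have m1 : (1 : R^o) \notin m.
  by apply/negP => /GV_full[J GJ]; exact: am.
have [||a u v|u v|p pE] := @ex_prime_ideal R (fun x : R => (x : R^o) \in m).
- exact: rpred0.
- exact/negP.
- by move=> um vm; apply: (@rpredD _ m) => //; apply: idealM.
- move=> uvm; apply: contrapT =>
    /not_orP[/negP/GVx[I GI IE] /negP/GVx[J GJ JE]].
  have [L GL LE] := GV_mul GI GJ; apply: (am L GL); apply: LE => x y.
  move=> /IE[a [z [zm ->]]] /JE[b [w [wm ->]]].
  have -> : (a * u + z) * (b * v + w) =
    (a * b) * (u * v) + ((b * v + w) * z + (a * u) * w) by ring.
  by apply: (@rpredD _ m); [|apply: (@rpredD _ m)]; apply: idealM.
by exists p => x; apply/idP/idP => /pE.
Qed.

End GVIdeals.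

(** * Injective envelopes and w-modules *)

Section Envelopes.
Variable R : idomainType.
Implicit Types M N E : lmodType R.

(* A maximal linear extension is found as a maximal single-valued submodule of *)
(* B * E containing the graph of f.                                            *)
Lemma divisible_injective E : torsion_free E ->
  (forall (r : R) (x : E), r != 0 -> exists y, r *: y = x) ->
    injective_module E.
Proof.
move=> tfE divE A B i f injI.
pose P (X : set (B * E)) := [/\
  forall a u v, X u -> X v -> X (a *: u + v),
  forall u x, X u -> X (u + (i x, f x)) &
  forall e, X (0, e) -> e = 0].
have Pbig F : (F `<=` P)%classic -> total_on F subset ->
  P (\bigcup_(X in F) X)%classic.
  move=> FP Ftot; split.
  - move=> a u v [X FX Xu] [Y FY Yv].
    have [XY|YX] := Ftot _ _ FX FY.
      by exists Y => //; have [H _ _] := FP _ FY; apply: H => //; exact: XY.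
    by exists X => //; have [H _ _] := FP _ FX; apply: H => //; exact: YX.
  - by move=> u x [X FX Xu]; exists X => //; have [_ H _] := FP _ FX; apply: H.
  by move=> e [X FX Xe]; have [_ _ H] := FP _ FX; apply: H.
have [G [[G1 G2 G3] Gmax]] := Zorn_bigcup Pbig.
have Pgraph : P [set u | exists x, u = (i x, f x)]%classic.
  split=> [a _ _ [x ->] [y ->]|_ y [x ->]|e [x [/esym ix0 ->]]].
  - by exists (a *: x + y); rewrite !linearP.
  - by exists (x + y); rewrite !linearD.
  by rewrite -(linear0 i) in ix0; rewrite (injI _ _ ix0) linear0.
have G0 : G 0.
  have [u Gu] : exists u, G u.
    apply: contrapT => nG; apply: (Gmax _ _ Pgraph).
    split=> [u Gu|]; first by case: nG; exists u.
    move=> H; apply: nG; exists (i 0, f 0); apply: H; by exists 0.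
  by have := G1 (-1) u u Gu Gu; rewrite scaleN1r addNr.
have Gif x : G (i x, f x) by rewrite -[(i x, _)]add0r; exact: G2.
have Gadd u v : G u -> G v -> G (u + v) by move=> Gu; rewrite -[u]scale1r;
  exact: G1.
have Gscale a u : G u -> G (a *: u) by move=> Gu; rewrite -[_ *: _]addr0;
  exact: G1.
(* If e agrees with G on the multiples of x already in its domain, then adjoining (x, e) keeps G
   single-valued, so by maximality (x, e) is in G. *)
have extend x e :
    (forall c e', G (- (c *: x), e') -> e' + c *: e = 0) -> exists e, G (x, e).
  move=> xe; exists e; apply: contrapT => nG.
  apply: (Gmax [set u | exists v c, G v /\ u = v + c *: (x, e)]%classic).
    split=> [u Gu|H]; first by exists u, 0; rewrite scale0r addr0.
    by apply/nG/H; exists 0, 1; rewrite scale1r add0r.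
  split=> [a _ _ [u [c [Gu ->]]] [v [d [Gv ->]]]|_ y [u [c [Gu ->]]]|e'
    [[b e1] [c [Gu []]]]].
  - exists (a *: u + v), (a * c + d); split; first exact: G1.
    by rewrite scalerDr scalerDl scalerA addrACA.
  - by exists (u + (i y, f y)), c; split; [exact: G2 | rewrite addrAC].
  move=> /esym/eqP; rewrite addr_eq0 => /eqP bE ->; apply: xe.
  by rewrite -bE.
(* If a nonzero multiple r x already has a value, divide that value by r; otherwise 0 can be chosen
   as the value at x. *)
have total x : exists e, G (x, e).
  have [[r [e [r0 Gre]]]|nx] := pselect (exists r e, r != 0 /\ G (r *: x, e)).
    have [e0 e0E] := divE r e r0; apply: (extend x e0) => c e' Gc.
    apply: (torsion_free_inj tfE r0); rewrite scaler0; apply: G3.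
    suff -> : (0, r *: (e' + c *: e0)) =
        r *: (- (c *: x), e') + c *: (r *: x, e) :> B * E.
      exact: Gadd (Gscale r _ Gc) (Gscale c _ Gre).
    congr pair; first by rewrite /= scalerN !scalerA mulrC addNr.
    by rewrite /= -e0E scalerDr !scalerA [c * r]mulrC.
  apply: (extend x 0) => c e' Gc; rewrite scaler0 addr0.
  have [c0|c0] := eqVneq c 0.
    by apply: G3; move: Gc; rewrite c0 scale0r oppr0.
  case: nx; exists (- c), e'; rewrite oppr_eq0 scaleNr; split=> //.
have [g gG] := choice total.
have gE x e : G (x, e) -> e = g x.
  move=> Ge; apply/eqP; rewrite -subr_eq0; apply/eqP/G3.
  suff -> : (0, e - g x) = -1 *: (x, g x) + (x, e) by exact: G1.
  by rewrite scaleN1r; congr pair; rewrite /= ?addNr // addrC.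
have lg : linear g by move=> a x y; apply/esym/gE;
  exact: (G1 a _ _ (gG x) (gG y)).
have [h hE] := ex_linear lg; exists h => x; rewrite hE.
by apply/esym/gE; exact: Gif.
Qed.

(** The envelope is the localization at the zero ideal, i.e. M tensored with the quotient field: it
    is torsion-free and divisible, hence injective, and essential because every fraction has a
    nonzero multiple in M. *)
Lemma ex_envelope M : torsion_free M ->
  exists E (i : {linear M -> E}), injective_envelope i.
Proof.
move=> tfM.
have [|||u v|p0 p0E] := @ex_prime_ideal R (fun x : R => x = 0).
- by [].
- by move/eqP; rewrite oner_eq0.
- by move=> a _ _ -> ->; rewrite mulr0 addr0.
- by move/eqP; rewrite mulf_eq0 => /orP[] /eqP; [left | right].
have notin0 r : (r \notin p0) = (r != 0).
  by congr negb; apply/idP/eqP => /p0E.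
have frac_eq (x y : M) s t : val t *: x = val s *: y -> frac (p := p0) x s =
  frac y t.
  by move=> E; apply/eqP/fracP; exists 1; rewrite ?notin0 ?oner_eq0 // !mul1r.
have [i iE] : exists i : {linear M -> localization p0 M}, forall x, i x =
  frac x (done1 p0).
  apply: ex_linear => a x y; rewrite scalefE addfE; apply: frac_eq.
  by rewrite /= !scale1r mul1r scale1r.
have frac0 (x : M) s : frac (p := p0) x s = 0 -> x = 0.
  have <- : frac 0 (done1 p0) = 0 :> localization p0 M by rewrite -iE linear0.
  move=> /eqP/fracP[c]; rewrite notin0 => c0.
  rewrite scaler0 => /(torsion_free_scale tfM)[/eqP|//].
  by rewrite mulr1 (negbTE c0).
have tfE : torsion_free (localization p0 M).
  move=> q /asboolP[r r0]; have [x [s ->]] := fracE q.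
  rewrite scalefE => /frac0/(torsion_free_scale tfM)[/eqP|->].
    by rewrite (negbTE r0).
  by rewrite -[RHS](linear0 i) iE; apply: frac_eq; rewrite !scaler0.
exists (localization p0 M), i; split.
- apply: divisible_injective => // r q r0; have [x [s ->]] := fracE q.
  have rp0 : r \notin p0 by rewrite notin0.
  exists (frac x (dmul (exist _ r rp0) s)); rewrite scalefE.
  by apply: frac_eq; rewrite /= scalerA mulrC.
- move=> x y /eqP; rewrite -subr_eq0 -linearB iE => /eqP/frac0/eqP.
  by rewrite subr_eq0 => /eqP.
move=> S iS q; have [x [s ->]] := fracE q => xS.
have s0 : val s != 0 by rewrite -notin0; exact: (valP s).
have isx : i x = val s *: frac x s.
  by rewrite iE scalefE; apply: frac_eq; rewrite /= scale1r.
have := iS x; rewrite isx rpredZ // => /(_ isT).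
by case/(torsion_free_scale tfE) => // /eqP; rewrite (negbTE s0).
Qed.

Lemma torsion_free_envelope M E (i : {linear M -> E}) :
  injective_envelope i -> torsion_free M -> torsion_free E.
Proof.
move=> [_ injI essI] tfM; apply: essI => x /asboolP[r r0].
rewrite -linearZ_LR -{1}(linear0 i) => /injI/(torsion_free_scale tfM).
by case=> [/eqP|->]; rewrite ?(negbTE r0) ?linear0.
Qed.

End Envelopes.

Section WModules.
Variable R : idomainType.
Implicit Types (M N E : lmodType R) (I J L : ideal R).

Lemma GV_cancel N J (x : N) : torsion_free N -> GV J ->
  (forall j, j \in J -> j *: x = 0) -> x = 0.
Proof.
move=> tfN /GV_neq0[j jJ j0] /(_ j jJ)/(torsion_free_scale tfN).
by case=> // /eqP; rewrite (negbTE j0).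
Qed.

Lemma torsion_free_GV N : torsion_free N -> GV_torsion_free N.
Proof. by move=> tfN x /asboolP[J GJ] /(GV_cancel tfN GJ). Qed.

(** Extend f to R by injectivity of the envelope; J carries the image of 1 into N, so that image
    lies in N_w = N. *)
Lemma w_module_hom N J (f : {linear subMod J -> N}) : w_module N -> GV J ->
  exists y, forall j, f j = val j *: y.
Proof.
move=> [_ [E [i [[injE injI _] clE]]]] GJ.
have [g gE] := injE _ _ (incl J) (i \o f) (@val_inj _ _ _).
have ifE j : i (f j) = val j *: g 1.
  rewrite -[LHS]gE -linearZ_LR; congr (g _); exact: (esym (mulr1 _)).
have : g 1 \in w_closure (image i).
  apply/asboolP; exists J => // j jJ; apply/asboolP; exists (f (exist _ j jJ)).
  by rewrite ifE.
rewrite clE => /asboolP[y yE]; exists y => j; apply: injI.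
by rewrite ifE -yE linearZ_LR.
Qed.

(** A criterion free of envelopes: an x in N_w gives the homomorphism j |-> j x from J to N; an
    element y of N inducing the same map equals x, because the envelope is torsion-free. *)
Lemma hom_w_module N : torsion_free N ->
  (forall J (f : {linear subMod J -> N}), GV J ->
    exists y, forall j, f j = val j *: y) -> w_module N.
Proof.
move=> tfN homN; split; first exact: torsion_free_GV.
have [E [i envi]] := ex_envelope tfN; exists E, i; split=> // x.
have tfE := torsion_free_envelope envi tfN; have [_ injI _] := envi.
apply/idP/idP => [/asboolP[J GJ Jx]|/asboolP[y <-]]; last first.
  apply/asboolP; have [J GJ] := GV1 R; exists J => // j _.
  by apply/asboolP; exists (j *: y); rewrite linearZ_LR.
have /choice[f fE] : forall j : subMod J, exists y, i y = val j *: x.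
  by move=> j; apply/asboolP/Jx; exact: (valP j).
have lf : linear f.
  by move=> a j k; apply: injI; rewrite linearP !fE /= scalerDl -scalerA.
have [g gE] := ex_linear lf; have [y yE] := homN J g GJ.
apply/asboolP; exists y; apply/eqP; rewrite -subr_eq0; apply/eqP.
apply: (GV_cancel tfE GJ) => j jJ; rewrite scalerBr -linearZ_LR.
by rewrite -[j]/(val (exist (fun x => x \in J) j jJ)) -yE gE fE subrr.
Qed.

(** An inclusion of J in I would be multiplication by an element of I, necessarily 1. *)
Lemma w_ideal_avoids_GV I : w_ideal I -> (1 : R^o) \notin I -> avoids_GV I.
Proof.
move=> wI I1 J GJ JI.
have [f fE] : exists f : {linear subMod J -> subMod I}, forall j, val (f j) =
  val j.
  pose f (j : subMod J) : subMod I := exist _ (val j) (JI _ (valP j)).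
  have [|g gE] := @ex_linear _ _ _ f; first by move=> a x y; exact: val_inj.
  by exists g => j; rewrite gE.
have [y yE] := w_module_hom f wI GJ; have [j jJ j0] := GV_neq0 GJ.
have := fE (exist _ j jJ); rewrite yE /= => jy.
case/negP: I1; suff <- : val y = (1 : R) by exact: (valP y).
by apply: (mulfI j0); rewrite mulr1.
Qed.

Lemma w_Max_avoids_GV (p : prime_idealr R) J :
  w_Max (prime_ideal p) -> GV J -> exists2 u, u \in J & u \notin p.
Proof.
move=> [wp p1 _] GJ; apply: contrapT => nJ.
apply: (w_ideal_avoids_GV wp p1 GJ) => u uJ; apply: contrapT => /negP up.
by apply: nJ; exists u.
Qed.

(* Zorn: an ideal containing no GV-ideal lies in a maximal such ideal, which   *)
(* is a maximal w-ideal.                                                       *)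
Lemma ideal_contains_GV I :
  (forall p : prime_idealr R, w_Max (prime_ideal p) ->
     exists2 u, u \in I & u \notin p) ->
  exists2 J, GV J & {subset J <= I}.
Proof.
move=> HI; apply: contrapT => nI.
have [|m [am Im maxm]] := @maximal_avoids_GV _ I.
  by move=> J GJ JI; apply: nI; exists J.
have [p pm] := maximal_avoids_GV_prime am maxm.
have ap : avoids_GV (prime_ideal p) by move=> J GJ Jp;
  apply: (am J GJ) => x /Jp; rewrite pm.
suff /HI[u uI /negP] : w_Max (prime_ideal p).
  by apply; have := Im u uI; rewrite -pm.
split; last 1 first.
- move=> L wL L1 pL x; rewrite pm; apply: maxm.
    exact: w_ideal_avoids_GV.
  by move=> y; rewrite -pm; exact: pL.
- apply: hom_w_module => [|J f GJ].
    exact/torsion_free_sub/torsion_free_regular.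
  (* Since J is a GV-ideal, f is multiplication by some r in R; r J lies in p and J does not, so r
     is in p. *)
  have /GVE[_ _ /(_ (incl _ \o f))[|r rE]] := GJ; first exact: linearP.
  have rp : (r : R^o) \in prime_ideal p.
    have [j jJ jp] : exists2 j : R, (j : R^o) \in J & j \notin p.
      apply: contrapT => nJ; apply: (ap J GJ) => u uJ;
        apply: contrapT => /negP up.
      by apply: nJ; exists u.
    have : r * j \in p.
      by rewrite -[j]/(val (exist (fun x => x \in J) j jJ)) -rE;
        exact: (valP (f _)).
    by rewrite prime_idealrM (negbTE jp) orbF.
  exists (exist _ r rp) => j; apply: val_inj; rewrite [LHS]rE /=; exact: mulrC.
by apply/negP => /GV_full[J GJ]; exact: ap.
Qed.

(** Local-global principle for elements: the conductor of x into A contains a GV-ideal exactly when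
    no maximal w-ideal contains it. *)
Lemma w_closureP (B : lmodType R) (A : submodClosed B) (x : B) :
  x \in w_closure A <->
  forall p : prime_idealr R, w_Max (prime_ideal p) ->
    exists2 u, u \notin p & u *: x \in A.
Proof.
split=> [/asboolP[J GJ Jx] p mp|Hx].
  by have [u uJ up] := w_Max_avoids_GV mp GJ; exists u => //; exact: Jx.
have [|a u v uA vA|I IE] := @ex_submod R R^o (fun r : R => r *: x \in A).
- by rewrite scale0r rpred0.
- rewrite -[_ *: x]/((a * u + v) *: x) scalerDl -scalerA.
  by apply: rpredD => //; apply: rpredZ.
have [|J GJ JI] := @ideal_contains_GV I.
  by move=> p /Hx[u up ux]; exists u => //; apply/IE.
by apply/asboolP; exists J => // r /JI/IE.
Qed.

End WModules.

(** * Local factorization through free modules *)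

Definition locally_valuation (R : idomainType) (p : prime_idealr R) :=
  forall a b : R, exists2 u : R, u \notin p &
    (exists c, u * a = c * b) \/ (exists c, u * b = c * a).

Definition w_valuation (R : idomainType) :=
  forall p : prime_idealr R, w_Max (prime_ideal p) -> locally_valuation p.

Section Valuation.
Variable R : idomainType.
Implicit Types (M N L : lmodType R) (p : prime_idealr R).

(** In a valuation domain one of finitely many elements divides all the others; u is a common
    denominator of the quotients. *)
Lemma valuation_dominant p (I : eqType) (a : I -> R) (s : seq I) i0 :
  locally_valuation p -> exists2 j, j \in i0 :: s &
    exists2 u, u \notin p & forall i, i \in i0 :: s ->
      exists c, u * a i = c * a j.
Proof.
move=> Vp; elim: s => [|k s [j js [u up uj]]].
  exists i0; rewrite ?mem_head //; exists 1; first exact: notin1.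
  by move=> i; rewrite inE => /eqP->; exists 1.
have mem_cons i : (i \in [:: i0, k & s]) = (i == k) || (i \in i0 :: s).
  by rewrite !inE orbCA.
have [w wp [[c wc]|[c wc]]] := Vp (a k) (a j).
  exists j; first by rewrite mem_cons js orbT.
  exists (u * w); first exact: notin_mul.
  move=> i; rewrite mem_cons => /orP[/eqP->|/uj[d dE]].
    by exists (u * c); rewrite -!(mulrA u) wc.
  by exists (w * d); rewrite [u * w]mulrC -!(mulrA w) dE.
exists k; first by rewrite mem_cons eqxx.
exists (u * w); first exact: notin_mul.
move=> i; rewrite mem_cons => /orP[/eqP->|/uj[d dE]]; first by exists (u * w).
by exists (d * c); rewrite [u * w]mulrC -(mulrA w) dE mulrCA wc mulrA.
Qed.

Lemma span_closure_scale M n m (v : 'I_n -> M) (w : 'I_m -> M) (u : R) x :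
  (forall i, u *: v i \in span w) ->
  x \in w_closure (span v) -> u *: x \in w_closure (span w).
Proof.
move=> vw /asboolP[J GJ Jx]; apply/asboolP; exists J => // r /Jx/asboolP[a rx].
rewrite scalerA mulrC -scalerA rx scaler_sumr; apply: rpred_sum => i _.
by rewrite scalerA mulrC -scalerA rpredZ.
Qed.

Lemma linear_comb L M (a : R) (f g : {linear L -> M}) :
  exists h : {linear L -> M}, forall x, h x = a *: f x + g x.
Proof.
apply: ex_linear => c x y /=;
  rewrite (linearP f) (linearP g) !scalerDr !scalerA [a * c]mulrC.
by rewrite addrACA.
Qed.

Lemma linear_scale L M (a : R) (f : {linear L -> M}) :
  exists h : {linear L -> M}, forall x, h x = a *: f x.
Proof.
by apply: ex_linear => c x y /=; rewrite (linearP f) scalerDr !scalerA mulrC.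
Qed.

(* Either v is free, or a relation between the v i lets one of them be dropped *)
(* after multiplying by an element outside p.                                  *)
Lemma local_splitting p N n (v : 'I_n -> N) L (f : {linear L -> N}) :
  locally_valuation p -> torsion_free N ->
  (forall x, f x \in w_closure (span v)) ->
  exists2 u, u \notin p & exists s : 'I_n -> {linear L -> R^o},
    forall x, \sum_i s i x *: v i = u *: f x.
Proof.
move=> Vp tfN; elim: n v f => [|n IH] v f fv; have [vfree|] :=
    pselect (forall a : 'I_ _ -> R, \sum_i a i *: v i = 0 -> forall i, a i = 0).
- exists 1; first exact: notin1.
  have f0 x : f x = 0.
    have /asboolP[J GJ Jx] := fv x;
      apply: (GV_cancel tfN GJ) => j /Jx/asboolP[a ->].
    by rewrite big_ord0.
  have [s0 _] := linear_zero L R^o.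
  by exists (fun=> s0) => x; rewrite big_ord0 f0 scaler0.
- by case=> a _ [].
- exists 1; first exact: notin1.
  have vinj (a b : 'I_n.+1 -> R) : \sum_i a i *: v i = \sum_i b i *: v i ->
    a =1 b.
    move=> ab i; apply/eqP; rewrite -subr_eq0; apply/eqP.
    apply: (vfree (fun i => a i - b i)).
    rewrite -[RHS](subrr (\sum_i a i *: v i)) {2}ab -sumrB.
    by apply: eq_bigr => k _; rewrite scalerBl.
  (* For free v the w-closure of the span adds nothing: the coordinates of j f(x) are linear in j,
     hence constant multiples of j because J is a GV-ideal. *)
  have /choice[s sE] x : exists r : 'I_n.+1 -> R, f x = \sum_i r i *: v i.
    have /asboolP[J GJ Jx] := fv x.
    have /choice[a aE] : forall j : subMod J, exists a : 'I_n.+1 -> R,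
        val j *: f x = \sum_i a i *: v i.
      by move=> j; apply/asboolP/Jx; exact: (valP j).
    have /choice[r rE] i : exists r, forall j, a j i = r * val j.
      have /GVE[_ _] := GJ; apply => c j k;
        apply: (vinj _ (fun i => c * a j i + a k i)).
      rewrite -aE [val _]/(c * val j + val k) scalerDl -scalerA !aE.
      rewrite scaler_sumr -big_split; apply: eq_bigr => l _ /=.
      by rewrite scalerA scalerDl.
    exists r; apply/eqP; rewrite -subr_eq0; apply/eqP/(GV_cancel tfN GJ) =>
      j jJ.
    rewrite scalerBr -[j]/(val (exist (fun x => x \in J) j jJ)) aE scaler_sumr.
    rewrite -sumrB big1 // => i _; rewrite rE scalerA mulrC.
    exact: subrr.
  have lin i : linear ((fun x => s x i) : L -> R^o).
    move=> c x y; apply: (vinj _ (fun i => c * s x i + s y i)).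
    rewrite -sE linearP !sE scaler_sumr -big_split; apply: eq_bigr => l _ /=.
    by rewrite scalerA scalerDl.
  have /choice[t tE] i := ex_linear (lin i); exists t => x.
  by rewrite scale1r sE; apply: eq_bigr => i _; rewrite tE.
move=> /asboolPn/existsp_asboolPn[a
  /asboolPn/imply_asboolPn[av /existsNP[k /eqP ak0]]].
(* Dividing the relation by its dominant coefficient a_j gives a relation c with c_j = u outside p,
   so u v_j lies in the span of the other generators. *)
have [j _ [u up uE]] := valuation_dominant a (enum 'I_n.+1) ord0 Vp.
have {uE}/choice[c cE] i : exists c, u * a i = c * a j.
  by apply: uE; rewrite inE mem_enum orbT.
have u0 : u != 0 by apply: contraNneq up => ->; rewrite rpred0.
have aj0 : a j != 0.
  have : u * a k != 0 by rewrite mulf_neq0.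
  by rewrite cE mulf_eq0 negb_or => /andP[].
have cj : c j = u by apply: (mulIf aj0); rewrite cE.
have cv : \sum_i c i *: v i = 0.
  apply: (torsion_free_inj tfN aj0); rewrite scaler0.
  transitivity (u *: \sum_i a i *: v i); last by rewrite av scaler0.
  rewrite !scaler_sumr; apply: eq_bigr => i _.
  by rewrite !scalerA cE mulrC.
have vj : u *: v j = \sum_i (- c (fintype.lift j i)) *: v (fintype.lift j i).
  apply/eqP; rewrite -cj -subr_eq0 -sumrN; apply/eqP; rewrite -[RHS]cv.
  rewrite [RHS](bigD1_ord j) //=; congr (_ + _).
  by apply: eq_bigr => i _; rewrite scaleNr opprK.
have vw i : u *: v i \in span (v \o fintype.lift j).
  case: (unliftP j i) => [i' ->|->].
    by rewrite rpredZ //; exact: (span_mem (v \o fintype.lift j)).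
  by rewrite vj; apply/asboolP; exists (fun i => - c (fintype.lift j i)).
have [g gE] := linear_scale u f.
have [x|u' u'p [s sE]] := IH (v \o fintype.lift j) g.
  by rewrite gE; exact: span_closure_scale vw (fv x).
have [s0 s0E] := linear_zero L R^o.
exists (u' * u); first exact: notin_mul.
exists (fun i => if unlift j i is Some i' then s i' else s0) => x.
rewrite (bigD1_ord j) //= unlift_none s0E scale0r add0r -scalerA -gE -sE.
by apply: eq_bigr => i _; rewrite liftK.
Qed.

(** The d for which d Id_N factors through R^n form an ideal; by [local_splitting] no maximal
    w-ideal contains it, so it contains a GV-ideal. *)
Lemma w_splitting N n (v : 'I_n -> N) :
  w_valuation R -> torsion_free N -> (forall x, x \in w_closure (span v)) ->
  exists m (d : 'I_m -> R^o) (s : 'I_m -> 'I_n -> {linear N -> R^o}),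
    GV (span d) /\ forall k x, \sum_i s k i x *: v i = (d k : R) *: x.
Proof.
move=> VR tfN vN.
have [||D DE] := @ex_submod R R^o (fun d : R =>
  exists s : 'I_n -> {linear N -> R^o},
  forall x, \sum_i s i x *: v i = d *: x).
- have [s0 s0E] := linear_zero N R^o.
  by exists (fun=> s0) => x; rewrite scale0r big1 // => i _;
    rewrite s0E scale0r.
- move=> a d e [s sE] [t tE].
  have /choice[h hE] i := linear_comb a (s i) (t i).
  exists h => x; rewrite -[RHS]/((a * d + e) *: x) scalerDl -scalerA -sE -tE.
  rewrite scaler_sumr -big_split; apply: eq_bigr => i _ /=.
  by rewrite hE scalerDl scalerA.
have [p mp|J GJ JD] := @ideal_contains_GV _ D.
  have [|u up [s sE]] := @local_splitting p N n v N idfun (VR p mp) tfN.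
    exact: vN.
  by exists u => //; apply/DE; exists s.
have [m [d [dJ Gd]]] := GV_fg GJ.
have /choice[s sE] k : exists s : 'I_n -> {linear N -> R^o},
  forall x, \sum_i s i x *: v i = (d k : R) *: x.
  by apply/DE/JD; rewrite dJ span_mem.
by exists m, d, s.
Qed.

End Valuation.

(** * The local form of the PvMD condition *)

Section PvMD.
Variable R : idomainType.
Local Notation K := (quotient_field R).

Lemma kscaleE (r : R) (x : K) : r *: x = tofrac r * x.
Proof. by []. Qed.

Lemma tofrac_inj : injective (@tofrac R).
Proof. by move=> x y /eqP; rewrite tofrac_eq => /eqP. Qed.

Lemma in_R_submod : exists S : submodClosed K, forall x, x \in S <-> in_R x.
Proof.
apply: ex_submod => [|a _ _ [r ->] [s ->]]; first by exists 0; rewrite tofrac0.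
by exists (a * r + s); rewrite kscaleE -tofracM -tofracD.
Qed.

Lemma mul_inverse_in_R (I : ideal R) x : x \in mul_inverse I -> in_R x.
Proof.
have [S SE] := in_R_submod; move=> /asboolP/(_ S) xS; apply/SE/xS.
by move=> _ [a [y [aI Iy ->]]]; apply/SE/Iy.
Qed.

(** For I = (a, b), some product e x with e in I and x in I^-1 is not in p. With s = a x and t = b x
    one has t a = s b, and s, t are not both in p, since e x is a combination of them. *)
Lemma PvMD_valuation : PvMD R -> w_valuation R.
Proof.
move=> PR p mp a b.
have [a0|a0] := eqVneq a 0.
  by exists 1; [exact: notin1 | left; exists 0; rewrite a0 mulr0 mul0r].
pose v (i : 'I_2) : R^o := if i == 0 then a else b.
pose I : ideal R := span v.
have aI : (a : R^o) \in I by exact: (span_mem v 0).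
have bI : (b : R^o) \in I by exact: (span_mem v 1).
have [|_] := PR I _ (ex_intro2 _ _ a a0 aI) 1; first by exists 2, v.
case/(_ _)/asboolP => [|J GJ J1]; first by exists 1; rewrite tofrac1.
have [r rJ rp] := w_Max_avoids_GV mp GJ.
have [S SE] : exists S : submodClosed K, forall x, x \in S <->
    exists2 s, s \in p & x = tofrac s.
  apply: ex_submod => [|c _ _ [s sp ->] [t tp ->]].
    by exists 0; rewrite ?rpred0 ?tofrac0.
  exists (c * s + t); first by rewrite rpredD // idealMr.
  by rewrite kscaleE -tofracM -tofracD.
have [e [x [eI Ix nex]]] : exists (e : R) (x : K),
    [/\ (e : R^o) \in I, inverse_ideal I x & ~ exists2 s, s \in p & e *: x =
      tofrac s].
  apply: contrapT => nx; have /asboolP/(_ S) := J1 r rJ.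
  case/(_ _)/SE => [_ [e [x [eI Ix ->]]]|s sp].
    by apply/SE; apply: contrapT => nex; apply: nx; exists e, x.
  by rewrite kscaleE mulr1 => /tofrac_inj rs; case/negP: rp; rewrite rs.
have [s sE] := Ix a aI; have [t tE] := Ix b bI.
have st : t * a = s * b.
  by apply: tofrac_inj; rewrite !tofracM -sE -tE !kscaleE [RHS]mulrAC
    [_ * tofrac a]mulrC [RHS]mulrC [tofrac b * _]mulrC mulrCA.
have [sp|sp] := boolP (s \in p); last by exists s => //; right; exists t.
have [tp|tp] := boolP (t \in p); last by exists t => //; left; exists s.
case: nex; have /asboolP[c ->] := eI; rewrite !big_ord_recl big_ord0 addr0.
exists (c 0 * s + c (fintype.lift 0 0) * t); first by rewrite rpredD // idealMr.
rewrite tofracD !tofracM -sE -tE !kscaleE tofracD !tofracM mulrDl !mulrA.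
by [].
Qed.

(** Near p, a dominant generator v_j satisfies u I in R v_j, so u / v_j is in I^-1 and u is in I
    I^-1. Conversely, what a GV-ideal carries into I I^-1, hence into R, lies in R. *)
Lemma valuation_PvMD : w_valuation R -> PvMD R.
Proof.
rewrite /PvMD /= => VR I [n [v vI]] [a0 a0n a0I].
suff one : (1 : K) \in w_closure (mul_inverse I).
  move=> x; split=> [/asboolP[J GJ Jx]|[r ->]]; last first.
    by rewrite -[tofrac r]mulr1; exact: (rpredZ r one).
  have [k kJ k0] := GV_neq0 GJ.
  have [c cE] := mul_inverse_in_R (Jx k kJ).
  have kn0 : tofrac k != 0 :> K by rewrite tofrac_eq0.
  have xE : x = tofrac c / tofrac k by rewrite -cE kscaleE mulrC mulKf.
  have /GVP[_ _ /(_ c k k0)[j /Jx/mul_inverse_in_R[d dE]|d dE]] := GJ.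
    exists d; apply: tofrac_inj; rewrite !tofracM -dE xE kscaleE.
    by rewrite -!mulrA mulVf ?mulr1.
  by exists d; rewrite xE dE tofracM mulfK.
apply/w_closureP => p mp.
have [i0 vi0] : exists i, v i != 0.
  apply: contrapT => nv; move: a0I a0n; rewrite vI => /asboolP[c ->].
  rewrite big1 ?eqxx // => i _; have [->|vi] := eqVneq (v i) 0;
    first exact: scaler0.
  by case: nv; exists i.
have [j _ [u up uE]] := @valuation_dominant R p _ v (enum 'I_n) i0 (VR p mp).
have {uE}/choice[c cE] i : exists c : R, u * v i = c * v j.
  by apply: uE; rewrite inE mem_enum orbT.
have u0 : u != 0 by apply: contraNneq up => ->; rewrite rpred0.
have vj0 : v j != 0.
  have : u * v i0 != 0 by rewrite mulf_neq0.
  by rewrite cE mulf_eq0 negb_or => /andP[].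
have tvj0 : tofrac (v j : R) != 0 :> K by rewrite tofrac_eq0.
exists u => //; apply/asboolP => S; apply.
exists (v j), (tofrac u / tofrac (v j : R)); split;
  first by rewrite vI span_mem.
  move=> e; rewrite vI => /asboolP[b ->]; exists (\sum_i b i * c i).
  have -> : \sum_i b i *: v i = \sum_i b i * v i :> R by [].
  rewrite kscaleE mulrA -tofracM mulr_suml.
  have -> : \sum_i b i * v i * u = (\sum_i b i * c i) * v j.
    by rewrite mulr_suml; apply: eq_bigr => i _;
      rewrite -!mulrA [v i * u]mulrC cE.
  by rewrite tofracM mulfK.
by rewrite !kscaleE mulr1 mulrC mulfVK.
Qed.

End PvMD.

(** * Free presentations and Ext *)

Section FreeModules.
Variable R : idomainType.
Implicit Types (K : choiceType) (M N : lmodType R).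

Lemma freegZ K (c : R) (x : K) : << c *g x >> = c *: << x >>.
Proof. by apply/eqP/freeg_eqP => y; rewrite coeffZ !coeffU mul1r. Qed.

Lemma freeg_linear_eq K N (f g : {linear {freeg K / R} -> N}) :
  (forall x, f << x >> = g << x >>) -> f =1 g.
Proof.
move=> fg D; rewrite -[D]freeg_sumE !linear_sum; apply: eq_bigr => x _.
by rewrite freegZ !linearZ_LR fg.
Qed.

Lemma augmentationU M (x : M) : augmentation (<< x >> : {freeg M / R}) = x.
Proof. by rewrite /augmentation liftU scale1r. Qed.

Lemma freeg_projective K : projective_module {freeg K / R}.
Proof.
move=> B C g f /choice[g' g'E].
pose h : {linear {freeg K / R} -> B} := fglift (fun x => g' (f << x >>)).
exists h; apply: (@freeg_linear_eq _ _ (g \o h) f) => x /=.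
by rewrite liftU scale1r g'E.
Qed.

Lemma torsion_free_freeg K : torsion_free {freeg K / R}.
Proof.
move=> D /asboolP[r r0 /eqP/freeg_eqP rD]; apply/eqP/freeg_eqP => x.
have /eqP := rD x; rewrite coeffZ !coeff0 mulf_eq0 (negbTE r0).
by move/eqP.
Qed.

(* Only the keys met by the images of finitely many generators of J matter.    *)
Lemma hom_freeg K (J : ideal R) (f : {linear subMod J -> {freeg K / R}}) :
  GV J -> exists D, forall j, f j = val j *: D.
Proof.
move=> GJ; have [[n [d dJ]] injJ surJ] := (GVE J).1 GJ.
have /choice[r rE] x : exists r, forall j, coeff x (f j) = r * val j.
  by apply: surJ => a j k; rewrite linearP coeffD coeffZ.
have dJ' i : d i \in J by rewrite dJ span_mem.
pose s := undup (flatten [seq dom (f (exist _ (d i) (dJ' i))) | i : 'I_n]).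
have r0 x : x \notin s -> r x = 0.
  move=> xs; apply: injJ => y; rewrite dJ; apply: sum_span => i.
  rewrite -[d i]/(val (exist (fun y => y \in J) _ (dJ' i))) -rE.
  apply: coeff_outdom; apply: contra xs => xi; rewrite mem_undup.
  apply/flattenP; exists (dom (f (exist _ (d i) (dJ' i)))) => //.
  by apply/mapP; exists i; rewrite ?mem_enum.
exists (\sum_(x <- s) << r x *g x >>) => j; apply/eqP/freeg_eqP => x.
rewrite rE coeffZ mulrC raddf_sum; congr (_ * _).
under eq_bigr => y _ do rewrite /= coeffU.
have [xs|xs] := boolP (x \in s).
  rewrite (bigD1_seq x) ?undup_uniq //= eqxx mulr1 big1 ?addr0 // =>
    y /negbTE->.
  by rewrite mulr0.
rewrite (r0 _ xs) big_seq big1 // => y ys.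
by case: eqP xs => [<-|_ _]; rewrite ?ys ?mulr0.
Qed.

(** A homomorphism from J is multiplication by some D of the free module, and D is a relation
    because J kills its augmentation. This makes the relation module a test module for
    w-projectivity. *)
Lemma relations_w_module M : torsion_free M -> w_module (relations M).
Proof.
move=> tfM; apply: hom_w_module => [|J f GJ].
  exact/torsion_free_sub/torsion_free_freeg.
have [D DE] := hom_freeg (incl _ \o f) GJ.
have Dker : D \in kernel (@augmentation R M).
  apply/eqP/(GV_cancel tfM GJ) => j jJ; rewrite -linearZ_LR.
  rewrite -[j]/(val (exist (fun y => y \in J) j jJ)) -DE.
  exact/eqP/(valP (f _)).
by exists (exist _ D Dker) => j; apply: val_inj; exact: DE.
Qed.

Lemma linear_corestrict M N (S : submodClosed N) (f : {linear M -> N}) :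
  (forall x, f x \in S) ->
  exists g : {linear M -> subMod S}, forall x, val (g x) = f x.
Proof.
move=> fS; pose g x : subMod S := exist _ (f x) (fS x).
have [|h hE] := @ex_linear _ _ _ g; last by exists h => x; rewrite hE.
by move=> a x y; apply: val_inj; exact: linearP.
Qed.

Section Ext.
Variables (W N : lmodType R) (c : R).

(** The map D |-> c D - s (augmentation D) sends the free module to relations and is multiplication
    by c on relations; composed with [eta] it extends c times [eta]. *)
Lemma Ext1_annihilated (s : {linear W -> {freeg W / R}}) (xi : Ext1 W N) :
  (forall w, augmentation (s w) = c *: w) -> c *: xi = 0.
Proof.
move=> augs; have [eta <-] := qproj_surj xi.
rewrite -linearZ_LR; apply/qproj_eq0.
have [t0 t0E] := linear_scale c
  (idfun : {linear {freeg W / R} -> {freeg W / R}}).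
have [t tE] := linear_comb (-1) (s \o @augmentation R W) t0.
have [D|f fE] := @linear_corestrict _ _ (kernel (@augmentation R W)) t.
  apply/eqP; rewrite tE t0E scaleN1r addrC raddfB /= augs.
  by rewrite linearZ_LR subrr.
have [g gE] := ex_linear (val_Hom_linear eta).
have lgf : linear (g \o f : {freeg W / R} -> N) by exact: linearP.
apply/asboolP; exists (mkHom lgf); apply: val_inj; apply/funext => D /=.
have -> : f (val D) = c *: D.
  apply: val_inj; rewrite fE tE t0E /=; have /eqP -> := valP D.
  by rewrite linear0 scaler0 add0r.
by rewrite linearZ_LR gE.
Qed.

End Ext.

(* Here xi is the class of the canonical presentation of W, i.e. of the        *)
(* identity of its module of relations.                                        *)
Lemma Ext1_relations (W : lmodType R) :
  exists xi : Ext1 W (relations W), forall c : R, c *: xi = 0 ->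
    exists s : {linear W -> {freeg W / R}},
      forall w, augmentation (s w) = c *: w.
Proof.
have lid : linear (idfun : relations W -> relations W) by [].
exists (qproj _ (mkHom lid)) => c;
  rewrite -linearZ_LR => /qproj_eq0/asboolP[h hE].
have [g gE] := ex_linear (val_Hom_linear h).
have gc (D : relations W) : val (g (val D)) = c *: val D.
  by rewrite gE; have /(congr1 (fun f => val (val f D))) := hE.
have [t0 t0E] := linear_scale c
  (idfun : {linear {freeg W / R} -> {freeg W / R}}).
(* c Id - g vanishes on relations, so it factors through the augmentation; the factor is the
   required lift s. *)
have [t tE] := linear_comb (-1) (incl _ \o g) t0.
have t_eq D D' : augmentation D = augmentation D' -> t D = t D'.
  move=> DD'; apply/eqP; rewrite -subr_eq0 -linearB tE t0E /=.
  have DD'ker : D - D' \in kernel (@augmentation R W).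
    by apply/eqP; rewrite linearB /= DD' subrr.
  by have /= -> := gc (exist (fun D =>
    D \in kernel (@augmentation R W)) _ DD'ker); rewrite scaleN1r addNr.
have augt D : augmentation (t D) = c *: augmentation D.
  rewrite tE t0E linearD linearZ_LR /= linearZ_LR /=;
    have /eqP -> := valP (g D).
  by rewrite scaler0 add0r.
have [w w'|s sE] := @ex_linear _ W {freeg W / R} (fun w => t << w >>).
  by move=> w''; rewrite -linearP; apply: t_eq;
    rewrite linearP /= !augmentationU.
by exists s => w; rewrite sE augt augmentationU.
Qed.

End FreeModules.


(** * w-finitely generated modules: w-splitting and w-projectivity from the local condition *)

Section WFinitelyGenerated.
Variable R : idomainType.
Implicit Types (M N : lmodType R).

Lemma fg_wfg M : finitely_generated M -> w_finitely_generated M.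
Proof.
move=> [n [v vM]].
have [f fE] : exists f : {linear 'rV[R]_n -> M}, forall x, f x =
  \sum_i x 0 i *: v i.
  apply: ex_linear => a x y; rewrite scaler_sumr -big_split;
    apply: eq_bigr => i _ /=.
  by rewrite !mxE scalerDl scalerA.
exists n, f => p mp q; have [x [s ->]] := fracE q.
have /asboolP[a ->] := vM x; exists (frac (\row_i a i) s).
by rewrite loc_mapE fE; congr frac; apply: eq_bigr => i _; rewrite mxE.
Qed.

(** Take the images of the standard basis: surjectivity at p puts a multiple u x, with u outside p,
    in their span. *)
Lemma wfg_span M : w_finitely_generated M ->
  exists n (v : 'I_n -> M), forall x, x \in w_closure (span v).
Proof.
move=> [n [f fepi]]; exists n, (fun i => f (delta_mx 0 i)) => x.
apply/w_closureP => p mp; have [q] := fepi p mp (frac x (done1 p)).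
have [y [s ->]] := fracE q; rewrite loc_mapE => /eqP/fracP[c cp cE].
exists (c * val s); first by apply: notin_mul => //; exact: (valP s).
rewrite -cE -linearZ_LR; apply/asboolP; exists (fun i => ((c * 1) *: y) 0 i).
rewrite [X in f X]row_sum_delta linear_sum; apply: eq_bigr => i _.
by rewrite linearZ_LR.
Qed.

Lemma span_closure_map M N (f : {linear M -> N}) n (v : 'I_n -> M) x :
  x \in w_closure (span v) -> f x \in w_closure (span (f \o v)).
Proof.
move=> /asboolP[J GJ Jx]; apply/asboolP; exists J => // r /Jx/asboolP[a rx].
rewrite -linearZ_LR rx linear_sum; apply/asboolP; exists a.
by apply: eq_bigr => i _; rewrite linearZ_LR.
Qed.

Lemma sum_linear M N n (s : 'I_n -> {linear M -> R^o}) (v : 'I_n -> N) :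
  exists h : {linear M -> N}, forall x, h x = \sum_i s i x *: v i.
Proof.
apply: ex_linear => a x y; rewrite scaler_sumr -big_split;
  apply: eq_bigr => i _ /=.
by rewrite linearP scalerDl scalerA.
Qed.

Lemma short_exact_kernel M N (g : {linear M -> N}) :
  surjective g -> short_exact (incl (kernel g)) g.
Proof.
move=> gsurj; split; [exact: incl_inj | move=> y | exact: gsurj];
  split=> [/eqP gy|[x <-]]; first by exists (exist _ y gy).
exact/eqP/(valP x).
Qed.

(** The factorization of d_k Id through R^n uses generators that are images of the v_i, so sending
    the i-th basis vector to v_i lifts it to M. *)
Lemma valuation_w_split M : w_valuation R -> w_finitely_generated M ->
  w_split (incl (torsion M)) (qproj (torsion M)).
Proof.
move=> VR /wfg_span[n [v vM]]; split; first exact: short_exact_quot.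
have [|m [d [s [Gd ds]]]] :=
    @w_splitting _ _ _ (qproj (torsion M) \o v) VR (@torsion_free_quot _ M).
  by move=> q; have [x <-] := qproj_surj q; exact: span_closure_map.
have /choice[h hE] k := sum_linear (s k) v.
exists m, d, h; split=> // k x; rewrite hE -ds linear_sum.
by apply: eq_bigr => i _; rewrite linearZ_LR.
Qed.

Lemma valuation_w_split_module M : w_valuation R -> w_finitely_generated M ->
  w_split_module (quotMod (torsion M)).
Proof.
move=> VR /wfg_span[n [v vM]].
exists (relations (quotMod (torsion M))), {freeg (quotMod (torsion M)) / R}.
exists (incl _), (@augmentation R _); split; first exact: freeg_projective.
split; first by apply: short_exact_kernel => x;
  exists << x >>; exact: augmentationU.
have [|m [d [s [Gd ds]]]] :=
    @w_splitting _ _ _ (qproj (torsion M) \o v) VR (@torsion_free_quot _ M).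
  by move=> q; have [x <-] := qproj_surj q; exact: span_closure_map.
have /choice[h hE] k :=
  sum_linear (s k) (fun i => << qproj (torsion M) (v i) >>).
exists m, d, h; split=> // k x; rewrite hE -ds linear_sum.
by apply: eq_bigr => i _; rewrite linearZ_LR /= augmentationU.
Qed.

Lemma torsion_free_tor_GV N x : torsion_free N -> x \in tor_GV N -> x = 0.
Proof. by move=> tfN /asboolP[J GJ Jx]; exact: (GV_cancel tfN GJ). Qed.

(** Here [tor_GV N] is zero, but [w_projective] still passes to the quotient by it. *)
Lemma torsion_free_quot_tor_GV N : torsion_free N ->
  torsion_free (quotMod (tor_GV N)).
Proof.
move=> tfN q /asboolP[r r0]; have [x <-] := qproj_surj q.
rewrite -linearZ_LR => /qproj_eq0/(torsion_free_tor_GV tfN).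
by move=> /(torsion_free_scale tfN)[/eqP|->]; rewrite ?(negbTE r0) ?linear0.
Qed.

Lemma sub_w_closure M (A : submodClosed M) x : x \in A -> x \in w_closure A.
Proof.
move=> xA; apply/asboolP; have [J GJ] := GV1 R; exists J => // r _.
exact: rpredZ.
Qed.

Lemma annihilator_span M n (d : 'I_n -> R^o) (x : M) :
  (forall k, (d k : R) *: x = 0) ->
  forall r : R, (r : R^o) \in span d -> r *: x = 0.
Proof.
move=> dx r /asboolP[a ->]; rewrite scaler_suml big1 // => k _.
by rewrite -[_ *: d k]/(a k * d k) -scalerA dx scaler0.
Qed.

Lemma w_envelope_embed M (E : lmodType R) (i : {linear M -> E}) :
  exists f : {linear M -> w_envelope i}, (forall x, val (f x) = i x) /\
    forall (p : prime_idealr R) (y : w_envelope i), w_Max (prime_ideal p) ->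
      exists2 u, u \notin p & exists x, u *: y = f x.
Proof.
have [x|f fE] := @linear_corestrict _ _ _ (w_closure (image i)) i.
  by apply/sub_w_closure/asboolP; exists x.
exists f; split=> // p y mp;
  have /w_closureP/(_ p mp)[u up /asboolP[x xE]] := valP y.
by exists u => //; exists x; apply: val_inj; rewrite fE xE.
Qed.

Lemma w_closure_span_trans M N (f : {linear M -> N}) n (v : 'I_n -> M) :
  (forall x, x \in w_closure (span v)) ->
  (forall (p : prime_idealr R) y, w_Max (prime_ideal p) ->
     exists2 u, u \notin p & exists x, u *: y = f x) ->
  forall y, y \in w_closure (span (f \o v)).
Proof.
move=> vM fN y; apply/w_closureP => p mp; have [u up [x xE]] := fN p y mp.
have /w_closureP/(_ p mp)[u' u'p u'x] := span_closure_map f (vM x).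
by exists (u' * u); [exact: notin_mul | rewrite -scalerA xE].
Qed.

(** Each d_k Id_W factors through R^n and so lifts along the augmentation; hence the GV-ideal
    generated by the d_k kills the extension. *)
Lemma valuation_Ext1 N (W : lmodType R) n (v : 'I_n -> W) : w_valuation R ->
  torsion_free W -> (forall y, y \in w_closure (span v)) ->
    GV_torsion (Ext1 W N).
Proof.
move=> VR tfW vW; have [m [d [s [Gd ds]]]] := w_splitting VR tfW vW.
move=> xi; pose J : ideal R := span d.
apply/asboolP; exists J => //; apply: annihilator_span => k.
have [h hE] := sum_linear (s k) (fun i => << v i >>).
apply: (@Ext1_annihilated _ _ _ _ h) => y; rewrite hE -ds linear_sum.
by apply: eq_bigr => l _; rewrite linearZ_LR /= augmentationU.
Qed.

Lemma valuation_w_projective M : w_valuation R -> w_finitely_generated M ->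
  w_projective (quotMod (torsion M)).
Proof.
move=> VR /wfg_span[n [v vM]].
have tfQ := torsion_free_quot_tor_GV (@torsion_free_quot _ M).
have vQ q : q \in w_closure
  (span (qproj (tor_GV _) \o (qproj (torsion M) \o v))).
  have [q1 <-] := qproj_surj q; have [x <-] := qproj_surj q1.
  exact/span_closure_map/span_closure_map.
have [E [i envi]] := ex_envelope tfQ; exists E, i; split=> // N tfN wN.
have [f [_ fW]] := w_envelope_embed i.
have := torsion_free_sub (torsion_free_envelope envi tfQ).
move=> /(_ (w_closure (image i))) tfW.
exact: (@valuation_Ext1 N (w_envelope i) _ _ VR tfW
  (w_closure_span_trans vQ fW)).
Qed.

End WFinitelyGenerated.

(** * From w-projectivity to the local condition *)

Section WProjective.
Variable R : idomainType.

Definition span_gen (M : lmodType R) n (v : 'I_n -> M) (i : 'I_n) :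
  subMod (span v) :=
  exist (fun x => x \in span v) (v i) (span_mem v i).

Lemma span_genP (M : lmodType R) n (v : 'I_n -> M) (x : subMod (span v)) :
  exists c : 'I_n -> R, x = \sum_i c i *: span_gen v i.
Proof.
have /asboolP[c cE] := valP x; exists c; apply: val_inj; rewrite [LHS]cE.
rewrite -[RHS]/(incl _ _) linear_sum; apply: eq_bigr => i _.
by rewrite linearZ_LR.
Qed.

Lemma span_finitely_generated (M : lmodType R) n (v : 'I_n -> M) :
  finitely_generated (subMod (span v)).
Proof.
exists n, (span_gen v) => x; have [c cE] := span_genP x.
by apply/asboolP; exists c.
Qed.

Lemma augmentation_sum (M : lmodType R) (D : {freeg M / R}) :
  augmentation D = \sum_(y <- dom D) coeff y D *: y.
Proof.
rewrite -[D in LHS]freeg_sumE linear_sum; apply: eq_bigr => y _.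
by rewrite freegZ linearZ_LR /= augmentationU.
Qed.

(** The model is W = (a, b)_w with a' = a and b' = b. Some d Id_W with d outside p lifts to the free
    module; the coordinates r, t of the lifts of d a' and d b' satisfy b r = a t. If one of them is
    outside p, the conclusion follows; if all are in p, expanding d a' gives e d a' = c a' with e
    outside p and c in p, which is absurd. *)
Lemma relations_local (W : lmodType R) (p : prime_idealr R)
    (a b : R) (a' b' : W) :
  w_Max (prime_ideal p) -> torsion_free W ->
  a != 0 -> a' != 0 -> b *: a' = a *: b' ->
  (forall y : W, exists2 e, e \notin p &
    exists c c', e *: y = c *: a' + c' *: b') ->
  GV_torsion (Ext1 W (relations W)) ->
  exists2 u : R, u \notin p & (exists c, u * a = c * b) \/
    (exists c, u * b = c * a).
Proof.
move=> mp tfW a0 a'0 ab Wspan HW.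
have [xi xiE] := Ext1_relations W.
have /asboolP[J GJ Jxi] := HW xi.
have [d dJ dp] := w_Max_avoids_GV mp GJ.
have [s sE] := xiE d (Jxi d dJ).
pose r y := coeff y (s a'); pose t y := coeff y (s b').
have rt y : b * r y = a * t y by rewrite -!coeffZ -!linearZ_LR ab.
have [[y [ry|ty]]|nrt] := pselect (exists y, r y \notin p \/ t y \notin p).
- by exists (r y) => //; right; exists (t y); rewrite mulrC rt mulrC.
- by exists (t y) => //; left; exists (r y); rewrite mulrC -rt mulrC.
have rp y : r y \in p by apply: contrapT => /negP ry; apply: nrt;
  exists y; left.
have tp y : t y \in p by apply: contrapT => /negP ty; apply: nrt;
  exists y; right.
(* Trades b' for a', so that the whole expansion becomes a multiple of a' with coefficient in p. *)
have rtb y : r y *: b' = t y *: a'.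
  apply: (torsion_free_inj tfW a0); rewrite scalerA mulrC -scalerA -ab.
  by rewrite !scalerA mulrC rt.
have [e ep [c cp ec]] : exists2 e, e \notin p &
    exists2 c, c \in p & e *: (\sum_(y <- dom (s a')) r y *: y) = c *: a'.
  elim: (dom (s a')) => [|y l [e ep [c cp ec]]].
    by exists 1; [exact: notin1 | exists 0;
      rewrite ?rpred0 // big_nil scaler0 scale0r].
  have [e1 e1p [c1 [c2 e1E]]] := Wspan y.
  exists (e * e1); first exact: notin_mul.
  exists (e * c1 * r y + e * c2 * t y + e1 * c);
    first by rewrite !rpredD // idealMr.
  rewrite big_cons scalerDr [in RHS]scalerDl; congr (_ + _).
    have -> : (e * e1) *: (r y *: y) = e *: (r y *: (e1 *: y)).
      by rewrite !scalerA; congr (_ *: _); ring.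
    have -> : r y *: (e1 *: y) = (r y * c1) *: a' + c2 *: (r y *: b').
      by rewrite e1E scalerDr !scalerA [c2 * _]mulrC.
    rewrite rtb scalerDl scalerDr !scalerA; congr (_ *: _ + _ *: _); ring.
  by rewrite mulrC -!scalerA ec.
case/negP: (notin_mul ep dp); suff -> : e * d = c by [].
apply/eqP; rewrite -subr_eq0.
have : (e * d - c) *: a' = 0.
  by rewrite scalerBl -ec -scalerA -sE augmentation_sum subrr.
by case/(torsion_free_scale tfW) => [->|/eqP]; rewrite ?(negbTE a'0).
Qed.

(** Passes from X to X_w: outside p every element of X_w has a multiple in X, and the relation
    module of X_w is a torsion-free w-module, so it can serve as N. *)
Lemma envelope_local (X E : lmodType R) (i : {linear X -> E})
    (p : prime_idealr R)
    (a b : R) (x y : X) :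
  w_Max (prime_ideal p) -> torsion_free X -> injective_envelope i ->
  a != 0 -> x != 0 -> b *: x = a *: y ->
  (forall z, exists c c', z = c *: x + c' *: y) ->
  (forall N : lmodType R, torsion_free N -> w_module N ->
    GV_torsion (Ext1 (w_envelope i) N)) ->
  exists2 u : R, u \notin p & (exists c, u * a = c * b) \/
    (exists c, u * b = c * a).
Proof.
move=> mp tfX envi a0 x0 xy Xspan HN.
have := torsion_free_sub (torsion_free_envelope envi tfX).
move=> /(_ (w_closure (image i))) tfW.
have [f [fi fW]] := w_envelope_embed i.
apply: (@relations_local (w_envelope i) p a b (f x) (f y)) => //.
- apply: contraNneq x0 => fx; have [_ injI _] := envi.
  have ix : i x = i 0 by rewrite linear0 -fi fx.
  by apply/eqP; exact: injI.
- by rewrite -!linearZ_LR xy.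
- move=> w; have [u up [z uw]] := fW p w mp; exists u => //.
  have [c [c' zE]] := Xspan z; exists c, c'; apply: (etrans uw).
  by rewrite zE linearD !linearZ_LR.
exact: HN (torsion_free_sub (@torsion_free_freeg _ _)) (relations_w_module tfW).
Qed.

Lemma w_projective_valuation :
  (forall M : lmodType R, finitely_generated M ->
    w_projective (quotMod (torsion M))) ->
  w_valuation R.
Proof.
move=> HP p mp a b; have [a0|a0] := eqVneq a 0.
  by exists 1; [exact: notin1 | left; exists 0; rewrite a0 mulr0 mul0r].
pose v (i : 'I_2) : R^o := if i == 0 then a else b.
have [E [i [envi HN]]] := HP _ (span_finitely_generated v).
have tfQ := @torsion_free_quot _ (subMod (span v)).
have tfM : torsion_free (subMod (span v))
  by exact/torsion_free_sub/torsion_free_regular.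
have tfQ' := torsion_free_quot_tor_GV tfQ.
(* The ideal (a, b) is torsion-free, so both quotients are by zero and q is injective. *)
pose q : {linear subMod (span v) -> _} :=
  qproj (tor_GV _) \o qproj (torsion (subMod (span v))).
apply: (@envelope_local _ _ i p a b (q (span_gen v 0)) (q (span_gen v 1))) =>
  //.
- apply: contraNneq a0 => /qproj_eq0/(torsion_free_tor_GV tfQ)/qproj_eq0/tfM.
  by move/(congr1 val) => v0; apply/eqP; exact: v0.
- by rewrite -!linearZ_LR; congr (q _); apply: val_inj; exact: mulrC.
move=> z; have [z1 <-] := qproj_surj z; have [x <-] := qproj_surj z1.
have [c cE] := span_genP x; exists (c 0), (c 1).
rewrite -[LHS]/(q x) cE linear_sum !big_ord_recl big_ord0 addr0 !linearZ_LR.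
have -> : fintype.lift ord0 ord0 = 1 :> 'I_2 by exact: val_inj.
by [].
Qed.

End WProjective.

(** * Tensor products and w-purity *)

Section Tensors.
Variable R : idomainType.
Implicit Types (N A B C Q : lmodType R) (p : prime_idealr R).

Lemma tensor_freeg N A (t : tensor N A) :
  exists D : {freeg (N * A)%type / R},
    t = qproj (generated (@bilinear_relations R N A)) D.
Proof. by have [D <-] := qproj_surj t; exists D. Qed.

Lemma tensor_linear_eq N A Q (f g : {linear tensor N A -> Q}) :
  (forall n a, f (pure_tensor n a) = g (pure_tensor n a)) -> f =1 g.
Proof.
move=> fg t; have [D ->] := tensor_freeg t.
apply: (@freeg_linear_eq R _ _ (f \o qproj _) (g \o qproj _)) => -[n a] /=.
exact: fg.
Qed.

Lemma tensor_lift N A Q (f : N -> A -> Q) :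
  (forall a, linear (f^~ a)) -> (forall n, linear (f n)) ->
  exists g : {linear tensor N A -> Q}, forall n a, g (pure_tensor n a) = f n a.
Proof.
move=> fl fr.
pose G : {linear {freeg (N * A)%type / R} -> Q} :=
  fglift (fun na => f na.1 na.2).
have GU n a : G << (n, a) >> = f n a by rewrite /G /= liftU scale1r.
have GZ r n a : G (r *: << (n, a) >>) = r *: f n a.
  by rewrite -GU; exact: linearZ_LR.
have lD a n n' : f (n + n') a = f n a + f n' a.
  by have := fl a 1 n n'; rewrite !scale1r.
have rD n a a' : f n (a + a') = f n a + f n a'.
  by have := fr n 1 a a'; rewrite !scale1r.
have f0a a : f 0 a = 0 by apply: (addrI (f 0 a)); rewrite -lD !addr0.
have fn0 n : f n 0 = 0 by apply: (addrI (f n 0)); rewrite -rD !addr0.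
have lZ r n a : f (r *: n) a = r *: f n a.
  by have := fl a r n 0; rewrite f0a !addr0.
have rZ r n a : f n (r *: a) = r *: f n a.
  by have := fr n r a 0; rewrite fn0 !addr0.
have G0 D : D \in generated (@bilinear_relations R N A) -> G D = 0.
  move=> /asboolP/(_ (kernel G)) GD; apply/eqP; apply: GD => {}D.
  case=> r [n [n' [a [a']]]] D_rel; apply/eqP.
  case: D_rel => ->; rewrite !linearB ?GZ ?GU.
  - by rewrite lD addrAC addrK subrr.
  - by rewrite rD addrAC addrK subrr.
  - by rewrite lZ subrr.
  - by rewrite rZ subrr.
have /choice[h hE] (t : tensor N A) : exists y : Q,
    forall D, t = qproj (generated (@bilinear_relations R N A)) D -> y = G D.
  have [D ->] := tensor_freeg t; exists (G D) => D' /quotModP/G0.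
  by rewrite linearB => /eqP; rewrite subr_eq0 => /eqP.
have lh : linear h.
  move=> c t t'; have [D tE] := tensor_freeg t;
    have [D' tE'] := tensor_freeg t'.
  rewrite (hE t D tE) (hE t' D' tE') -linearP; apply: hE.
  by rewrite tE tE'; apply: esym; exact: linearP.
have [g gE] := ex_linear lh; exists g => n a.
by rewrite gE -GU; exact: hE.
Qed.

Lemma pure_tensor0l N A (a : A) : pure_tensor (0 : N) a = 0.
Proof. by rewrite -[X in pure_tensor X](scale0r 0) pure_tensorZl scale0r. Qed.

Lemma pure_tensor0r N A (n : N) : pure_tensor n (0 : A) = 0.
Proof. by rewrite -[X in pure_tensor _ X](scale0r 0) pure_tensorZr scale0r. Qed.

Lemma tensor_ind N A (S : submodClosed (tensor N A)) :
  (forall n a, pure_tensor n a \in S) -> forall t, t \in S.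
Proof.
move=> pureS t; have [z zE] := linear_zero (tensor N A) (quotMod S).
apply/qproj_eq0; rewrite -(zE t);
  apply: (@tensor_linear_eq _ _ _ (qproj S)) => n a.
by rewrite zE; apply/qproj_eq0.
Qed.

(** Lifting c to B is well defined modulo the image of N (x) A, and so induces an inverse to the map
    from the cokernel of N (x) f to N (x) C. *)
Lemma tensor_right_exact N A B C (f : {linear A -> B}) (g : {linear B -> C}) :
  exact_seq f g -> surjective g ->
  exact_seq (tensor_map N f) (tensor_map N g) /\ surjective (tensor_map N g).
Proof.
move=> fg gsurj; split; last first.
  move=> t; suff : t \in image (tensor_map N g) by move/asboolP.
  apply: tensor_ind => n c; apply/asboolP; have [b <-] := gsurj c.
  by exists (pure_tensor n b); exact: tensor_mapE.
have /choice[s sE] := gsurj.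
pose I : submodClosed (tensor N B) := image (tensor_map N f).
have gI n b b' : g b = g b' -> qproj I (pure_tensor n b) =
  qproj I (pure_tensor n b').
  move=> gbb'; apply/quotModP/asboolP.
  have [|a aE] := (fg (b - b')).1; first by rewrite linearB gbb' subrr.
  exists (pure_tensor n a); apply: (etrans (tensor_mapE _ _ _)); rewrite aE.
  by rewrite -scaleN1r pure_tensorDr pure_tensorZr scaleN1r.
have [c|n|h hE] := @tensor_lift N C (quotMod I) (fun n c =>
  qproj I (pure_tensor n (s c))).
- by move=> r n n'; rewrite pure_tensorDl pure_tensorZl linearP.
- move=> r c c'; rewrite -linearP -pure_tensorZr -pure_tensorDr; apply: gI.
  by rewrite linearP !sE.
have hg : h \o tensor_map N g =1 qproj I.
  apply: (@tensor_linear_eq _ _ _ (h \o tensor_map N g)) => n b /=.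
  by rewrite tensor_mapE hE; apply: gI; rewrite sE.
move=> t; split=> [gt|[t' <-]].
  have : qproj I t = 0 by rewrite -hg /= gt linear0.
  by move/qproj_eq0/asboolP.
have [z zE] := linear_zero (tensor N A) (tensor N C).
rewrite -[RHS](zE t'); apply:
  (@tensor_linear_eq _ _ _ (tensor_map N g \o tensor_map N f)).
move=> n a; rewrite zE /= !tensor_mapE.
by have -> : g (f a) = 0; [apply/fg; exists a | exact: pure_tensor0r].
Qed.

Lemma frac_eq0 p A (a : A) s :
  frac (p := p) a s = 0 <-> exists2 c, c \notin p & c *: a = 0.
Proof.
have <- : frac 0 (done1 p) = 0 :> localization p A.
  by have := scalefE 0 (0 : A) (done1 p); rewrite !scale0r.
split=> [/eqP/fracP[c cp]|[c cp ca]].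
  by rewrite scaler0 mulr1 => ca; exists c.
by apply/eqP/fracP; exists c => //; rewrite scaler0 mulr1.
Qed.

Lemma loc_short_exact p A B C (f : {linear A -> B}) (g : {linear B -> C}) :
  exact_seq f g -> surjective g ->
  (forall a, f a = 0 -> exists2 u, u \notin p & u *: a = 0) ->
  short_exact (loc_map p f) (loc_map p g).
Proof.
move=> fg gsurj f0; split.
- move=> q q' /eqP; rewrite -subr_eq0 -linearB => /eqP fq.
  apply/eqP; rewrite -subr_eq0; apply/eqP; move: fq; move: (q - q') => {q q'} q.
  have [a [s ->]] := fracE q; rewrite /= loc_mapE => /frac_eq0[c cp].
  rewrite -linearZ_LR => /f0[u up]; rewrite scalerA => ua.
  by apply/frac_eq0; exists (u * c) => //; exact: notin_mul.
- move=> q; split=> [|[q' <-]].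
    have [b [s ->]] := fracE q; rewrite /= loc_mapE => /frac_eq0[c cp].
    rewrite -linearZ_LR => /fg[a aE].
    exists (frac a (dmul (exist _ c cp) s)); rewrite /= loc_mapE aE.
    apply/eqP/fracP; exists 1; first exact: notin1.
    by rewrite scalerA !mul1r mulrC.
  have [a [s ->]] := fracE q'; rewrite /= !loc_mapE; apply/frac_eq0.
  by exists 1; rewrite ?notin1 // scale1r; apply/fg; exists a.
move=> q; have [c [s ->]] := fracE q; have [b <-] := gsurj c.
by exists (frac b s); rewrite /= loc_mapE.
Qed.

(** Tensoring is right exact and localization exact, so only injectivity on the left, up to elements
    outside p, is in question. *)
Lemma w_pure_local A B C (f : {linear A -> B}) (g : {linear B -> C}) :
  short_exact f g ->
  w_pure f g <-> forall N p (t : tensor N A), w_Max (prime_ideal p) ->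
    tensor_map N f t = 0 -> exists2 u, u \notin p & u *: t = 0.
Proof.
move=> sfg; have [_ fg gsurj] := sfg; split=> [[_ pure_fg] N p t mp ft|fg0].
  have [inj_f _ _] := pure_fg N p mp; apply/(@frac_eq0 _ _ _ (done1 p))/inj_f.
  by rewrite /= loc_mapE /= ft linear0; apply/frac_eq0;
    exists 1; rewrite ?notin1 ?scaler0.
split=> // N p mp; have [ex_t surj_t] := tensor_right_exact N fg gsurj.
by apply: loc_short_exact => // t; exact: fg0.
Qed.

(** Some c = d_k is outside p. The map c Id - h g sends B into A and is multiplication by c on A;
    tensored with N, it shows that c kills the kernel of N (x) f. *)
Lemma w_split_w_pure A B C (f : {linear A -> B}) (g : {linear B -> C}) :
  w_split f g -> w_pure f g.
Proof.
move=> [sfg [n [d [h [Gd gh]]]]]; apply/(w_pure_local sfg) => N p t mp ft.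
pose J : ideal R := span d.
have [k dk] : exists k, (d k : R) \notin p.
  apply: contrapT => nk; have [u uJ /negP] := @w_Max_avoids_GV _ p J mp Gd;
    apply.
  apply: (span_subset (S := prime_ideal p)) uJ => k.
  by apply: contrapT => /negP dk; apply: nk; exists k.
have {gh} := gh k; move: (h k) (d k : R) dk => {d h k Gd J} h c cp gh.
exists c => //; have [injf fg _] := sfg.
have [t0 t0E] := linear_scale c (idfun : {linear B -> B}).
have [t1 t1E] := linear_comb (-1) (h \o g) t0.
have /choice[r rE] b : exists a, f a = t1 b.
  by apply/fg; rewrite t1E t0E scaleN1r linearD linearN linearZ_LR /= gh addNr.
have lr : linear r by move=> e x y; apply: injf; rewrite linearP !rE linearP.
have [r' r'E] := ex_linear lr.
have [z zE] := linear_scale c (idfun : {linear tensor N A -> tensor N A}).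
have <- : z t = c *: t by rewrite zE.
suff <- : tensor_map N r' (tensor_map N f t) = z t by rewrite ft linear0.
apply: (@tensor_linear_eq _ _ _ (tensor_map N r' \o tensor_map N f)) => m a.
rewrite /= !tensor_mapE zE /= -pure_tensorZr; congr pure_tensor.
apply: injf; rewrite r'E rE t1E t0E /=.
have -> : g (f a) = 0 by apply/fg; exists a.
by rewrite linear0 scaler0 add0r linearZ_LR.
Qed.

Lemma w_split_module_w_split A :
  w_split_module (quotMod (torsion A)) ->
    w_split (incl (torsion A)) (qproj (torsion A)).
Proof.
move=> [L [P [f [g [projP [_ [n [d [h [Gd gh]]]]]]]]]].
split; first exact: short_exact_quot.
have [l lE] := projP _ _ (qproj (torsion A)) g (@qproj_surj _ _ _).
by exists n, d, (fun k => l \o h k); split=> // k x; rewrite /= lE gh.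
Qed.

(** For I the span of v, this is (R / I) (x) A = A / I A; S is I A. *)
Lemma tensor_quot_span n (v : 'I_n -> R^o) A (t : A) (u : R) :
  u *: pure_tensor (qproj (span v) 1) t = 0 ->
  exists a : 'I_n -> A, u *: t = \sum_i v i *: a i.
Proof.
have [||S SE] := @ex_submod R A (fun t => exists a : 'I_n -> A, t =
  \sum_i v i *: a i).
- by exists (fun=> 0); rewrite big1 // => i _; rewrite scaler0.
- move=> c _ _ [a ->] [b ->]; exists (fun i => c *: a i + b i).
  rewrite scaler_sumr -big_split; apply: eq_bigr => i _ /=.
  by rewrite scalerDr !scalerA mulrC.
have vS (r : R) x : (r : R^o) \in span v -> r *: x \in S.
  move=> /asboolP[c ->]; apply/SE; exists (fun i => c i *: x).
  rewrite scaler_suml; apply: eq_bigr => i _.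
  by rewrite -[_ *: v i]/(c i * v i) scalerA mulrC.
pose f (q : quotMod (span v)) (x : A) : quotMod S :=
  qproj S ((repr q : R) *: x).
have fE (r : R) x : f (qproj (span v) r) x = qproj S (r *: x).
  apply/quotModP; rewrite -scalerBl; apply: vS.
  by apply/quotModP; rewrite reprK.
have [x|q|g gE] := @tensor_lift (quotMod (span v)) A (quotMod S) f.
- move=> c q q'; have [r <-] := qproj_surj q; have [r' <-] := qproj_surj q'.
  by rewrite -linearP !fE scalerDl -scalerA linearP.
- by move=> c x x'; rewrite /f scalerDr scalerA mulrC -scalerA linearP.
move=> /(congr1 g); rewrite linear0 linearZ_LR gE fE scale1r -linearZ_LR.
by move=> /qproj_eq0/SE.
Qed.

(* With L the relation module of the ideal (a, b), purity of L / aL in         *)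
(* R^2 / aL, tested on R / (a, b), puts (b, -a) into aL + bL locally at p.     *)
Lemma w_pure_valuation :
  (forall M : lmodType R, finitely_generated M ->
    w_pure_submodule (torsion M)) ->
  w_valuation R.
Proof.
move=> HP p mp a b; have [a0|a0] := eqVneq a 0.
  by exists 1; [exact: notin1 | left; exists 0; rewrite a0 mulr0 mul0r].
pose F : lmodType R := (R^o * R^o)%type.
have [|c x y|S SE] := @ex_submod R F (fun x => exists2 l : F,
  (l.1 : R) * a + (l.2 : R) * b = 0 & x = a *: l).
- by exists 0; rewrite ?scaler0 //= !mul0r addr0.
- move=> [l lE ->] [l' l'E ->]; exists (c *: l + l'); last first.
    by rewrite scalerDr !scalerA mulrC.
  rewrite -[LHS]/((c * l.1 + l'.1) * a + (c * l.2 + l'.2) * b).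
  have -> : (c * l.1 + l'.1) * a + (c * l.2 + l'.2) * b =
    c * (l.1 * a + l.2 * b) + (l'.1 * a + l'.2 * b) by ring.
  by rewrite lE l'E mulr0 addr0.
pose M := quotMod S; pose e1 : F := (1, 0); pose e2 : F := (0, 1).
have fgM : finitely_generated M.
  exists 2, (fun i => if i == 0 then qproj S e1 else qproj S e2) => q.
  have [[x y] <-] := qproj_surj q; apply/asboolP.
  exists (fun i => if i == 0 then x else y);
    rewrite !big_ord_recl big_ord0 addr0 /=.
  rewrite -!linearZ_LR -linearD; congr (qproj S _); congr pair => /=.
    by rewrite scaler0 addr0; exact: esym (mulr1 _).
  by rewrite scaler0 add0r; exact: esym (mulr1 _).
(* R^2 / L is isomorphic to the torsion-free module (a, b), so the torsion of R^2 / aL lies in L /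
   aL. *)
have torM (x : F) : qproj S x \in torsion M -> x.1 * a + x.2 * b = 0.
  move=> /asboolP[r r0]; rewrite -linearZ_LR => /qproj_eq0/SE[l lE [e1x e2x]].
  apply: (mulfI r0); rewrite mulr0 mulrDr !mulrA.
  rewrite -[r * x.1]/((r *: x.1 : R^o) : R) -[r * x.2]/((r *: x.2 : R^o) :
    R) e1x e2x.
  by rewrite -[LHS]/(a * l.1 * a + a * l.2 * b) -!mulrA -mulrDr lE mulr0.
pose z0 : F := (b, - a).
have z0T : qproj S z0 \in torsion M.
  apply/asboolP; exists a => //; rewrite -linearZ_LR; apply/qproj_eq0/SE.
  by exists z0 => //=; rewrite mulNr mulrC subrr.
pose z : subMod (torsion M) := exist (fun x => x \in torsion M) _ z0T.
pose v (i : 'I_2) : R^o := if i == 0 then a else b.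
pose N := quotMod (span v).
have [sM _] := HP M fgM.
have /(w_pure_local sM)/(_ N p (pure_tensor (qproj (span v) 1) z) mp) :=
  HP M fgM.
case=> [|u up /tensor_quot_span[t]].
  (* In R^2 / aL the class of [z0] is b e1 - a e2, and a, b kill R / (a, b), so the tensor
     vanishes. *)
  rewrite tensor_mapE.
  have nv (r : R) : (r : R^o) \in span v -> r *: qproj (span v) 1 = 0.
    move=> rv; rewrite -linearZ_LR; apply/qproj_eq0.
    by rewrite -[_ *: _]/(r * 1) mulr1.
  have -> : incl (torsion M) z = b *: qproj S e1 + (- a) *: qproj S e2.
    rewrite -!linearZ_LR -linearD; congr (qproj S _); congr pair => /=.
      by rewrite scaler0 addr0; exact: esym (mulr1 _).
    by rewrite scaler0 add0r; exact: esym (mulr1 _).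
  rewrite pure_tensorDr !pure_tensorZr -!pure_tensorZl !nv ?pure_tensor0l
    ?addr0 //.
    by rewrite rpredN; exact: (span_mem v 0).
  exact: (span_mem v 1).
rewrite !big_ord_recl big_ord0 addr0.
move: (t ord0) (t (fintype.lift ord0 ord0)) => t1 t2 tE.
have [x1 x1E] := qproj_surj (val t1); have [x2 x2E] := qproj_surj (val t2).
have x1T : x1.1 * a + x1.2 * b = 0 by apply: torM; rewrite x1E;
  exact: (valP t1).
have x2T : x2.1 * a + x2.2 * b = 0 by apply: torM; rewrite x2E;
  exact: (valP t2).
(* u z0 = a x1 + b x2 + a l with x1, x2, l in L; the first coordinates are compared. *)
have /qproj_eq0/SE[l lE [zE _]] : qproj S (u *: z0 - (a *: x1 + b *: x2)) = 0.
  have qE : u *: qproj S z0 = a *: qproj S x1 + b *: qproj S x2.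
    by rewrite x1E x2E; exact: (congr1 val tE).
  have -> : qproj S (u *: z0 - (a *: x1 + b *: x2)) =
      u *: qproj S z0 - (a *: qproj S x1 + b *: qproj S x2).
    by rewrite linearB linearD !linearZ_LR.
  by rewrite qE subrr.
(* If the first coordinate of x2 is outside p, the relation x2 itself suffices; otherwise u minus it
   is outside p and multiplies b into R a. *)
have [x2p|x2p] := boolP ((x2.1 : R) \in p); last first.
  exists x2.1 => //; left; exists (- x2.2); apply/eqP.
  by rewrite mulNr -addr_eq0 x2T.
exists (u - x2.1).
  by apply: contra up => ux; rewrite -[u](subrK x2.1) rpredD.
right; exists (x1.1 + l.1).
have {zE} : u * b - (a * x1.1 + b * x2.1) = a * l.1 by exact: zE.
move: (x1.1 : R) (x2.1 : R) (l.1 : R) => y1 y2 l1 zE.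
have -> : (u - y2) * b = u * b - (a * y1 + b * y2) + a * y1 by ring.
by rewrite zE; ring.
Qed.

End Tensors.

(** * w-purity of the torsion submodule under the local condition *)

Section Purity.
Variable R : idomainType.
Implicit Types (M N A Q : lmodType R).

Lemma tensor_sum N A (t : tensor N A) :
  exists l : seq (N * A), t = \sum_(x <- l) pure_tensor x.1 x.2.
Proof.
have [||S SE] := @ex_submod R (tensor N A)
  (fun t => exists l : seq (N * A), t = \sum_(x <- l) pure_tensor x.1 x.2).
- by exists [::]; rewrite big_nil.
- move=> c _ _ [l ->] [l' ->]; exists ([seq (c *: x.1, x.2) | x <- l] ++ l').
  rewrite big_cat big_map scaler_sumr; congr (_ + _).
  by apply: eq_bigr => x _; rewrite pure_tensorZl.
apply/SE/tensor_ind => n a; apply/SE; exists [:: (n, a)].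
by rewrite big_seq1.
Qed.

(* A vanishing formal sum of pairs is a combination of finitely many           *)
(* relations, so it vanishes under every map bilinear on a submodule           *)
(* containing the finitely many elements of M these involve.                   *)
Lemma tensor_vanish_finite N M (D : {freeg (N * M)%type / R}) :
  D \in generated (@bilinear_relations R N M) ->
  exists s : seq M, forall (S : submodClosed M) Q (f : N -> M -> Q),
    {in s, forall x, x \in S} ->
    {in S, forall a, linear (f^~ a)} ->
    (forall n r, {in S &, forall a a',
      f n (r *: a + a') = r *: f n a + f n a'}) ->
    fglift (fun x => f x.1 x.2) D = 0.
Proof.
move=> Dgen.
have [||T TE] := @ex_submod R {freeg (N * M)%type / R} (fun D =>
  exists s : seq M, forall (S : submodClosed M) Q (f : N -> M -> Q),
    {in s, forall x, x \in S} ->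
    {in S, forall a, linear (f^~ a)} ->
    (forall n r, {in S &, forall a a',
      f n (r *: a + a') = r *: f n a + f n a'}) ->
    fglift (fun x => f x.1 x.2) D = 0).
- by exists [::] => S Q f *; exact: linear0.
- move=> c D1 D2 [s1 H1] [s2 H2]; exists (s1 ++ s2) => S Q f sS fl fr.
  have E1 : fglift (fun x => f x.1 x.2) D1 = 0.
    by apply: (H1 S) => // x xs; apply: sS; rewrite mem_cat xs.
  have E2 : fglift (fun x => f x.1 x.2) D2 = 0.
    by apply: (H2 S) => // x xs; apply: sS; rewrite mem_cat xs orbT.
  by rewrite linearP /= E1 E2 scaler0 addr0.
suff relT : (bilinear_relations (A := M) `<=` [set` T])%classic.
  by apply/TE; move: Dgen => /asboolP; apply.
move=> {Dgen}D [r [n [n' [a [a' D_rel]]]]]; apply/TE.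
exists [:: a; a'] => S Q f sS fl fr.
have aS : a \in S by apply: sS; rewrite mem_head.
have a'S : a' \in S by apply: sS; rewrite !inE eqxx orbT.
pose G : {linear {freeg (N * M)%type / R} -> Q} := fglift (fun x => f x.1 x.2).
rewrite -[LHS]/(G D).
have GU m b : G << (m, b) >> = f m b by rewrite /G /= liftU scale1r.
have GZ c m b : G (c *: << (m, b) >>) = c *: f m b.
  by rewrite -GU; exact: linearZ_LR.
have f0a : f 0 a = 0 by have := fl a aS 1 0 0;
  rewrite !scale1r addr0 -[in LHS](addr0 (f 0 a)) => /addrI.
have fn0 : f n 0 = 0.
  by have := fr n 1 0 0 (rpred0 S) (rpred0 S);
    rewrite !scale1r addr0 -[in LHS](addr0 (f n 0)) => /addrI.
case: D_rel => ->; rewrite !linearB ?GZ ?GU.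
- have := fl a aS 1 n n'; rewrite !scale1r => ->.
  by rewrite addrAC addrK subrr.
- have := fr n 1 a a' aS a'S; rewrite !scale1r => ->.
  by rewrite addrAC addrK subrr.
- by have := fl a aS r n 0; rewrite f0a !addr0 => ->; rewrite subrr.
by have := fr n r a 0 aS (rpred0 S); rewrite fn0 !addr0 => ->; rewrite subrr.
Qed.

(* On a finitely generated submodule, x |-> u x - sum_i (s_i x) v_i is a       *)
(* retraction onto the torsion up to the factor u.                             *)
Lemma local_torsion_retraction (p : prime_idealr R) M n (v : 'I_n -> M) :
  locally_valuation p ->
  exists2 u, u \notin p &
    exists f : {linear subMod (span v) -> subMod (torsion M)},
    forall x, val x \in torsion M -> val (f x) = u *: val x.
Proof.
move=> Vp; have [x|u up [s sE]] :=
  @local_splitting _ p _ n (qproj (torsion M) \o v) _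
    (qproj (torsion M) \o incl (span v)) Vp (@torsion_free_quot _ M).
  have xv : val x \in w_closure (span v) by apply: sub_w_closure;
    exact: (valP x).
  exact: (span_closure_map (qproj (torsion M)) xv).
exists u => //; have [h hE] := sum_linear s v.
have [g gE] := linear_scale u (incl (span v)).
have [t tE] := linear_comb (-1) h g.
have [x|f fE] := @linear_corestrict _ _ _ (torsion M) t.
  apply/qproj_eq0; rewrite tE gE scaleN1r linearD linearN linearZ_LR hE.
  rewrite addrC; apply/eqP; rewrite subr_eq0 linear_sum; apply/eqP.
  by apply: (etrans (esym (sE x))); apply: eq_bigr => i _; rewrite linearZ_LR.
exists f => x /asboolP[r r0 rx];
  rewrite fE tE gE hE big1 ?scaler0 ?add0r // => i _.
suff -> : s i x = 0 by rewrite scale0r.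
apply: torsion_free_regular; apply/asboolP; exists r => //.
rewrite -linearZ_LR; have -> : r *: x = 0 by exact: val_inj.
exact: linear0.
Qed.

(** The vanishing of t in N (x) M involves finitely many elements of M. On the span of these and of
    the torsion elements occurring in t, the local retraction f is available, and evaluating n (x)
    f(x) on the vanishing sum [D] gives u t = 0. *)
Lemma valuation_w_pure M : w_valuation R -> w_pure_submodule (torsion M).
Proof.
move=> VR; apply/(w_pure_local (short_exact_quot _)) => N p t mp ft.
have [l tE] := tensor_sum t.
pose D : {freeg (N * M)%type / R} := \sum_(x <- l) << (x.1, val x.2) >>.
have /tensor_vanish_finite[s sE] : D \in generated (@bilinear_relations R N M).
  apply/qproj_eq0; apply: (etrans _ ft); rewrite tE !linear_sum.
  by apply: eq_bigr => x _; apply: esym; exact: tensor_mapE.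
pose s' := s ++ [seq val x.2 | x <- l].
pose v (i : 'I_(size s')) := s'`_i.
have vs x : x \in s' -> x \in span v.
  by move=> xs; rewrite -(nth_index 0 xs);
    exact: (span_mem v (Ordinal (etrans (index_mem _ _) xs))).
have [u up [f fE]] := local_torsion_retraction v (VR p mp); exists u => //.
(* [g] extends f by 0 outside the span, to a function on all of M; bilinearity is only claimed on
   the span. *)
have /choice[g gE] x : exists y, forall xv : x \in span v, y =
  f (exist (fun x => x \in span v) x xv).
  have [xv|nxv] := pselect (is_true (x \in span v)); last by exists 0 => xv;
    case: nxv.
  by exists (f (exist _ x xv)) => xv'; congr (f _); exact: val_inj.
have := sE (span v) _ (fun n x => pure_tensor n (g x)).
have -> : fglift (fun x => pure_tensor x.1 (g x.2)) D = u *: t.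
  rewrite tE scaler_sumr linear_sum big_seq [RHS]big_seq;
    apply: eq_bigr => x xl.
  have xv : val x.2 \in span v.
    by apply: vs; rewrite mem_cat (map_f (fun x => val x.2)) ?orbT.
  rewrite /= liftU scale1r /= (gE _ xv) -pure_tensorZr; congr pure_tensor.
  by apply: val_inj; apply: fE; exact: (valP x.2).
apply.
- by move=> x xs; apply: vs; rewrite mem_cat xs.
- by move=> a av c n n'; rewrite pure_tensorDl pure_tensorZl.
move=> n r a a' av a'v; rewrite -pure_tensorZr -pure_tensorDr;
  congr pure_tensor.
have aa'v : r *: a + a' \in span v by rewrite rpredD ?rpredZ.
rewrite (gE _ av) (gE _ a'v) (gE _ aa'v) -linearP; congr (f _); exact: val_inj.
Qed.

End Purity.

(** * The cycle of implications, through the local condition *)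

Theorem theorem2p5 (R : idomainType) :
  [<-> PvMD R;
       forall M : lmodType R, w_pure_submodule (torsion M);
       forall M : lmodType R, finitely_generated M ->
         w_pure_submodule (torsion M);
       forall M : lmodType R, finitely_generated M ->
         w_projective (quotMod (torsion M));
       forall M : lmodType R, w_finitely_generated M ->
         w_projective (quotMod (torsion M));
       forall M : lmodType R, finitely_generated M ->
         w_split_module (quotMod (torsion M));
       forall M : lmodType R, w_finitely_generated M ->
         w_split_module (quotMod (torsion M));
       forall M : lmodType R, finitely_generated M ->
         w_split (incl (torsion M)) (qproj (torsion M));
       forall M : lmodType R, w_finitely_generated M ->
         w_split (incl (torsion M)) (qproj (torsion M))].
Proof.
have split_valuation : (forall M : lmodType R, finitely_generated M ->
    w_split (incl (torsion M)) (qproj (torsion M))) -> w_valuation R.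
  by move=> H; apply: w_pure_valuation => M /H; exact: w_split_w_pure.
tfae.
- by move=> /PvMD_valuation VR M; exact: valuation_w_pure.
- by move=> H M _; exact: H.
- by move=> /w_pure_valuation VR M /fg_wfg; exact: valuation_w_projective.
- by move=> /w_projective_valuation VR M; exact: valuation_w_projective.
- move=> H M /fg_wfg; apply: valuation_w_split_module.
  by apply: w_projective_valuation => N /fg_wfg; exact: H.
- move=> H M; apply: valuation_w_split_module; apply: split_valuation => N /H.
  exact: w_split_module_w_split.
- by move=> H M /fg_wfg/H; exact: w_split_module_w_split.
- by move=> /split_valuation VR M; exact: valuation_w_split.
move=> H; apply/valuation_PvMD/split_valuation => M /fg_wfg; exact: H.
Qed.
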